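(* Let $L$ be an anisotropic $2$-dimensional Lorentzian lattice, with $S$, its order, and (canonical) $M$-supplements as in the context. Let $r_0\in S$ be a primitive lattice vector, let $M>0$, and let $l_0$ be the canonical $r_0^2$-supplement of $r_0$. Then the algorithm $\mathsf{Anisotropic}(M,r_0,l_0)$ below terminates. If $L$ has no spacelike vectors of norm $\leq M$, then it says so. Otherwise, it returns a generator $g$ of $\mathrm{SO}^{\uparrow}(L)$ and a nonempty sequence $\mathcal{R}=(r_1,r_2,\dots,r_n)$ of vectors, such that $$r_1,\dots,r_n,\ g(r_1),\dots,g(r_n),\ g^2(r_1),\dots,g^2(r_n),\dots$$ is the sequence, in ascending order, of all primitive lattice vectors in $S$ that have norm $\leq M$ and come after $r_0$. 1. Set $(r_1,l_1)\leftarrow\mathsf{NotPromised}(M,r_0,l_0)$, unless $\mathsf{NotPromised}(M,r_0,l_0)$ reports nonexistence. In the latter case, stop: $L$ has no spacelike vectors with norm $\leq M$. 2. Set $\mathcal{R}$ to be the one-term sequence $(r_1)$, set $(r,l)\leftarrow(r_1,l_1)$, and set $A\leftarrow\begin{pmatrix}r^2&r\cdot l\\ r\cdot l&l^2\end{pmatrix}$. 3. Set $(r,l)\leftarrow\mathsf{Promised}(M,r,l)$ and then $l\leftarrow\mathsf{Canonical}(M,r,l)$. 4. If the inner product matrix of $(r,l)$ equals $A$, then set $g$ to be the linear transformation sending $(r_1,l_1)$ to $(r,l)$, and return $g$ and $\mathcal{R}$. 5. Append $r$ to $\mathcal{R}$, and go to step 3.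
   Context: A Lorentzian lattice of dimension $2$ is a free abelian group $L$ of rank $2$ with a $\mathbb{Q}$-valued symmetric bilinear form $v\cdot w$ of signature $(1,1)$; $v^2=v\cdot v$ is the norm. It is anisotropic if it has no nonzero vectors of norm $0$. A vector is primitive if it generates a direct summand of $L$; spacelike means positive norm. $\mathrm{SO}^{\uparrow}(L)$ is the group of isometries of $L$ of determinant $1$ that preserve each of the two light cones (i.e. each of the two components of the set of negative norm vectors of $L\otimes\mathbb{R}$); it is isomorphic to $\mathbb{Z}$ when $L$ is anisotropic. Let $P=L\otimes\mathbb{R}$. The set of nonzero vectors of $P$ of nonnegative norm has two components; $S$ is one of them. Fix an orientation of $P$. For nonproportional $v,w\in S$, $v$ precedes $w$ (and $w$ comes after $v$) if the basis $(v,w)$ of $P$ represents the orientation; this totally orders the primitive lattice vectors in $S$. An oriented basis is a $\mathbb{Z}$-basis of $L$ representing the orientation. For $M>0$ and a primitive lattice vector $r\in S$, an $M$-supplement of $r$ is an $l\in L$ such that $(r,l)$ is an oriented basis and $l$ does not lie in the interior of the convex hull of the norm $M$ hyperbola in $S$ (i.e. it is not the case that $l\in S$ and $l^2>M$). The canonical $M$-supplement of $r$ is the unique $M$-supplement $l$ of $r$ for which $l+r$ is not an $M$-supplement of $r$. Subroutines, given by their specifications. $\mathsf{Canonical}(M,r,l)$: for $(r,l)$ an oriented basis with $r\in S$, returns the canonical $M$-supplement of $r$. $\mathsf{Promised}(M,r,l)$: given a primitive $r\in S$, an $M$-supplement $l$ of $r$, and assuming $S$ contains a primitive lattice vector of norm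 $\leq M$ after $r$, returns $(r',l')$ with $r'$ the first such vector and $l'$ an $M$-supplement of $r'$. $\mathsf{NotPromised}(M,r,l)$: given a primitive $r\in S$, its canonical $r^2$-supplement $l$, and $M>0$, reports nonexistence if $L$ has no spacelike vectors of norm $\leq M$, and otherwise returns $(r',l')$ where $r'$ is the first primitive lattice vector of norm $\leq M$ in $S$ after $r$ and $l'$ is the canonical $M$-supplement of $r'$. *)

(* Defs.v *)
From HB Require Import structures.
From mathcomp Require Import all_boot all_order all_algebra.
From mathcomp Require Import all_classical all_reals all_analysis.
Import Order.TTheory GRing.Theory Num.Theory.
Import numFieldNormedType.Exports.

Set Implicit Arguments.
Unset Strict Implicit.
Unset Printing Implicit Defensive.

Local Open Scope classical_set_scope.
Local Open Scope ring_scope.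

Definition intcomb (L : zmodType) (b : 2.-tuple L) (c : 'rV[int]_2) : L :=
  \sum_(i < 2) tnth b i *~ c 0 i.

Definition Zbasis (L : zmodType) (b : 2.-tuple L) : Prop :=
  forall x : L, exists! c : 'rV[int]_2, x = intcomb b c.

(* Coordinates of x in b; only meaningful when b is a Z-basis. *)
Definition intcoord (L : zmodType) (b : 2.-tuple L) (x : L) : 'rV[int]_2 :=
  xget 0 [set c | x = intcomb b c].

(* When b is a Z-basis, the linear map sending b`_0, b`_1 to b'`_0, b'`_1. *)
Definition linmap (L : zmodType) (b b' : 2.-tuple L) (x : L) : L :=
  intcomb b' (intcoord b x).

Definition gram (L : zmodType) (form : L -> L -> rat) (b : 2.-tuple L) :
    'M[rat]_2 :=
  \matrix_(i, j) form (tnth b i) (tnth b j).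

(* A form with Gram matrix G can be diagonalized with one positive and one
   negative diagonal coefficient. *)
Definition signature11 (G : 'M[rat]_2) : Prop :=
  exists (Q : 'M[rat]_2) (d : 'rV[rat]_2),
    [/\ Q \in unitmx, Q *m G *m Q^T = diag_mx d, 0 < d 0 0 & d 0 1 < 0].

Record lorentzian2 := Lorentzian2 {
  lat :> zmodType;
  dot : lat -> lat -> rat;
  lat_rank2 : exists b : 2.-tuple lat, Zbasis b;
  dot_sym : forall v w, dot v w = dot w v;
  dotDl : forall u v w, dot (u + v) w = dot u w + dot v w;
  dot_signature : forall b : 2.-tuple lat, Zbasis b -> signature11 (gram dot b)
}.

Definition norm2 (L : lorentzian2) (v : L) : rat := dot v v.

Definition anisotropic (L : lorentzian2) : Prop :=
  forall v : L, norm2 v = 0 -> v = 0.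

(* v *~ n, for n : int, ranges over the subgroup generated by v, and K is a
   complement of this subgroup. *)
Definition primitive (L : zmodType) (v : L) : Prop :=
  exists K : {pred L},
    [/\ zmod_closed K,
        forall x : L, exists (n : int) (k : L), k \in K /\ x = v *~ n + k
      & forall n : int, v *~ n \in K -> v *~ n = 0].

(* P is realized as 'rV[R]_2, in the coordinates of an arbitrary Z-basis of L
   chosen once and for all. *)
Definition refbasis (L : lorentzian2) : 2.-tuple L := sval (cid (lat_rank2 L)).

Definition toP (R : realType) (L : lorentzian2) (v : L) : 'rV[R]_2 :=
  map_mx intr (intcoord (refbasis L) v).

Definition dotP (R : realType) (L : lorentzian2) (x y : 'rV[R]_2) : R :=
  (x *m map_mx ratr (gram (@dot L) (refbasis L)) *m y^T) 0 0.

Definition component (R : realType) (A C : set 'rV[R]_2) : Prop :=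
  exists2 x, A x & C = connected_component A x.

Definition nonneg_vectors (R : realType) (L : lorentzian2) : set 'rV[R]_2 :=
  [set x | x != 0 /\ 0 <= dotP L x x].

Definition neg_vectors (R : realType) (L : lorentzian2) : set 'rV[R]_2 :=
  [set x | dotP L x x < 0].

Arguments nonneg_vectors : clear implicits.
Arguments neg_vectors : clear implicits.

(* The rows of endo_mx g are the coordinates of the images of the basis, so
   that g acts on coordinates by x |-> x *m endo_mx g. *)
Definition endo_mx (L : lorentzian2) (g : L -> L) : 'M[int]_2 :=
  \matrix_(i < 2) intcoord (refbasis L) (g (tnth (refbasis L) i)).

Definition endoP (R : realType) (L : lorentzian2) (g : L -> L)
    (x : 'rV[R]_2) : 'rV[R]_2 :=
  x *m map_mx intr (endo_mx g).

Definition isometry_of (L : lorentzian2) (g : L -> L) : Prop :=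
  [/\ {morph g : x y / x + y}, bijective g
    & forall v w, dot (g v) (g w) = dot v w].

Definition SOup (R : realType) (L : lorentzian2) (g : L -> L) : Prop :=
  [/\ isometry_of g, \det (endo_mx g) = 1
    & forall C : set 'rV[R]_2,
        component (neg_vectors R L) C -> endoP g @` C = C].

(* The second disjunct says that h is the n-th power of the inverse of g. *)
Definition generates_SOup (R : realType) (L : lorentzian2) (g : L -> L) : Prop :=
  SOup R g /\
  forall h : L -> L, SOup R h ->
    exists n : nat, (forall v, h v = iter n g v) \/
                    (forall v, iter n g (h v) = v).

(* An orientation of P is given by a reference basis, the rows of the
   invertible matrix o. *)
Definition oriented (R : realType) (o : 'M[R]_2) (x y : 'rV[R]_2) : Prop :=
  0 < \det ((\matrix_(i < 2) tnth [tuple x; y] i) *m invmx o).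

Definition precedes (R : realType) (L : lorentzian2) (S : set 'rV[R]_2)
    (o : 'M[R]_2) (v w : L) : Prop :=
  [/\ S (toP R v), S (toP R w) & oriented o (toP R v) (toP R w)].

Definition oriented_basis (R : realType) (L : lorentzian2) (o : 'M[R]_2)
    (v w : L) : Prop :=
  Zbasis [tuple v; w] /\ oriented o (toP R v) (toP R w).

Definition supplement (R : realType) (L : lorentzian2) (S : set 'rV[R]_2)
    (o : 'M[R]_2) (M : R) (r l : L) : Prop :=
  oriented_basis o r l /\ ~ (S (toP R l) /\ M < ratr (norm2 l)).

Definition canonical_supplement (R : realType) (L : lorentzian2)
    (S : set 'rV[R]_2) (o : 'M[R]_2) (M : R) (r l : L) : Prop :=
  supplement S o M r l /\ ~ supplement S o M r (l + r).

Definition short_after (R : realType) (L : lorentzian2) (S : set 'rV[R]_2)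
    (o : 'M[R]_2) (M : R) (r x : L) : Prop :=
  [/\ primitive x, S (toP R x), ratr (norm2 x) <= M & precedes S o r x].

Definition first_short_after (R : realType) (L : lorentzian2)
    (S : set 'rV[R]_2) (o : 'M[R]_2) (M : R) (r x : L) : Prop :=
  short_after S o M r x /\
  forall y : L, short_after S o M r y -> y = x \/ precedes S o x y.

Definition no_short_spacelike (R : realType) (L : lorentzian2) (M : R) : Prop :=
  forall v : L, 0 < norm2 v -> ~ ratr (norm2 v) <= M.

Definition Canonical_spec (R : realType) (L : lorentzian2) (S : set 'rV[R]_2)
    (o : 'M[R]_2) (canonical : R -> L -> L -> L) : Prop :=
  forall (M : R) (r l : L),
    0 < M -> S (toP R r) -> oriented_basis o r l ->
    canonical_supplement S o M r (canonical M r l).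

Definition Promised_spec (R : realType) (L : lorentzian2) (S : set 'rV[R]_2)
    (o : 'M[R]_2) (promised : R -> L -> L -> L * L) : Prop :=
  forall (M : R) (r l : L),
    0 < M -> primitive r -> S (toP R r) -> supplement S o M r l ->
    (exists x : L, short_after S o M r x) ->
    first_short_after S o M r (promised M r l).1 /\
    supplement S o M (promised M r l).1 (promised M r l).2.

(* None is the report of nonexistence. *)
Definition NotPromised_spec (R : realType) (L : lorentzian2)
    (S : set 'rV[R]_2) (o : 'M[R]_2)
    (notPromised : R -> L -> L -> option (L * L)) : Prop :=
  forall (M : R) (r l : L),
    0 < M -> primitive r -> S (toP R r) ->
    canonical_supplement S o (ratr (norm2 r)) r l ->
    (no_short_spacelike L M -> notPromised M r l = None) /\
    (~ no_short_spacelike L M ->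
       exists r' l' : L,
         [/\ notPromised M r l = Some (r', l'),
             first_short_after S o M r r' &
             canonical_supplement S o M r' l']).

Inductive output (L : lorentzian2) :=
  | NoShortSpacelike
  | Generator of (L -> L) & seq L.

(* Running rs r l is the state at the start of a pass through the loop of the
   algorithm, with the current values of the sequence and of (r, l). *)
Inductive state (L : lorentzian2) :=
  | Running of seq L & L & L
  | Halted of output L.

Definition innermx (L : lorentzian2) (r l : L) : 'M[rat]_2 :=
  gram (@dot L) [tuple r; l].

Section Anisotropic.
Context (R : realType) (L : lorentzian2).
Context (canonical : R -> L -> L -> L).
Context (promised : R -> L -> L -> L * L).
Context (notPromised : R -> L -> L -> option (L * L)).
Context (M : R) (r0 l0 : L).

Definition Anisotropic_body (r1 l1 : L) (s : state L) : state L :=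
  match s with
  | Halted out => Halted out
  | Running rs r l =>
      let r' := (promised M r l).1 in
      let l' := canonical M r' (promised M r l).2 in
      if innermx r' l' == innermx r1 l1 then
        Halted (Generator (linmap [tuple r1; l1] [tuple r'; l']) rs)
      else Running (rcons rs r') r' l'
  end.

(* The state after n passes through the loop. *)
Definition Anisotropic_state (n : nat) : state L :=
  match notPromised M r0 l0 with
  | None => Halted (NoShortSpacelike L)
  | Some (r1, l1) => iter n (Anisotropic_body r1 l1) (Running [:: r1] r1 l1)
  end.

Definition Anisotropic_returns (out : output L) : Prop :=
  exists n : nat, Anisotropic_state n = Halted out.

End Anisotropic.

(* The k-th term of rs, g(rs), g^2(rs), ... where rs is nonempty. *)
Definition unrolled (L : lorentzian2) (g : L -> L) (rs : seq L) (k : nat) : L :=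
  iter (k %/ size rs)%N g (nth 0 rs (k %% size rs)%N).

Definition ascending_enumeration (R : realType) (L : lorentzian2)
    (S : set 'rV[R]_2) (o : 'M[R]_2) (X : set L) (u : nat -> L) : Prop :=
  range u = X /\ forall i j : nat, (i < j)%N -> precedes S o (u i) (u j).

(* Main.v *)
Require Import Defs.
From HB Require Import structures.
From mathcomp Require Import all_boot all_order all_algebra.
From mathcomp Require Import all_classical all_reals all_analysis.
From mathcomp Require Import ring lra zify.
Import Order.TTheory GRing.Theory Num.Theory.
Import numFieldNormedType.Exports.

Local Open Scope classical_set_scope.
Local Open Scope ring_scope.

Set Implicit Arguments.
Unset Strict Implicit.
Unset Printing Implicit Defensive.

(**
Over the reals, the quadratic form of a Lorentzian plane is a product [p * m] of two linear
forms, its null coordinates, and everything in the theorem can be read off from the pair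
[(p, m)] ([null_coordinates_exist]).  With suitable signs, lattice vectors of [S] are those with
[p > 0] and [m > 0]; [v] precedes [w] if the area [p v * m w - m v * p w] is positive, that is,
if the slope [m / p] increases; and the elements of SO-up are the boosts, the lattice
automorphisms that multiply [p] by some [t > 0] and [m] by [t^-1].

A contracting boost, one with [t < 1], exists by an argument along Conway's river: starting from
a basis [(a, b)] with [a] of positive and [b] of negative norm whose cone contains the ray
[p = 0], one repeatedly replaces [a] or [b] by [a + b] so as to keep these signs.  The area of
the basis being constant, its Gram matrices take finitely many values, so one of them recurs,
and the map between the two bases is a boost; it contracts because [p a - p b] decreases along
the walk ([contracting_boost_exists]).

The specifications of the subroutines make the successive pairs [(r, l)] of the algorithm a
sequence in which every [r] is the first short vector after the previous one and [l] is its
canonical supplement; the boosts respect both notions.  A contracting boost moves any vector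
of [S] forward, so there is always a next short vector.  The slopes of the vectors [r] grow by
at least a constant, because the areas spanned by consecutive ones are multiples of the
covolume; hence every short vector after [r1] occurs ([traj_reaches]).  In particular the image
of [r1] under a contracting boost occurs, and since canonical supplements are unique the initial
Gram matrix recurs: the loop stops ([returns_exists]).

If it first recurs after [k] steps, the returned map [g] is a boost and shifts the whole sequence
by [k] ([period_shift]), which is the claimed enumeration.  Any boost or its inverse takes
[(r1, l1)] to a pair in the sequence with the initial Gram matrix; up to a power of [g] the index
of this pair is less than [k], hence [0] by minimality, so the boost is a power of [g]
([period_generates]).
*)

(** * Bases of rank two lattices and their automorphisms *)

Lemma ord2P (P : 'I_2 -> Prop) : P 0 -> P 1 -> forall i, P i.
Proof.
move=> P0 P1 [[|[|//]] h]; [rewrite (_ : Ordinal h = 0) | rewrite (_ : Ordinal h = 1)] => //;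
  exact: val_inj.
Qed.

Lemma sum2 (V : nmodType) (F : 'I_2 -> V) : \sum_(i < 2) F i = F 0 + F 1.
Proof. by rewrite big_ord_recl big_ord1; congr (_ + F _); apply: val_inj. Qed.

Section ZBases.
Context (L : zmodType).
Implicit Types (b : 2.-tuple L) (c d : 'rV[int]_2) (x y : L).

Lemma intcombE b c : intcomb b c = tnth b 0 *~ c 0 0 + tnth b 1 *~ c 0 1.
Proof. exact: sum2. Qed.

Lemma intcombD b c d : intcomb b (c + d) = intcomb b c + intcomb b d.
Proof. by rewrite !intcombE !mxE !mulrzDr addrACA. Qed.

Lemma intcoordK b x : Zbasis b -> intcomb b (intcoord b x) = x.
Proof.
move=> /(_ x)[c [xc _]]; have ex : exists c, [set c | x = intcomb b c] c by exists c.
by rewrite [RHS](xgetPex 0 ex).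
Qed.

Lemma intcombK b c : Zbasis b -> intcoord b (intcomb b c) = c.
Proof.
move=> bb; have [d [_ uniq]] := bb (intcomb b c).
by rewrite -(uniq c)// (uniq (intcoord b (intcomb b c)))// intcoordK.
Qed.

Lemma intcoordD b x y : Zbasis b -> intcoord b (x + y) = intcoord b x + intcoord b y.
Proof. by move=> bb; rewrite -[RHS](intcombK _ bb) intcombD !intcoordK. Qed.

Lemma intcoord_tnth b i : Zbasis b -> intcoord b (tnth b i) = delta_mx 0 i.
Proof.
move=> bb; rewrite -[RHS](intcombK _ bb); congr intcoord.
by rewrite intcombE !mxE; elim/ord2P: i; rewrite /= ?mulr0z ?mulr1z ?addr0 ?add0r.
Qed.

Lemma ZbasisP x y : Zbasis [tuple x; y] <->
  (forall v, exists i j : int, v = x *~ i + y *~ j) /\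
  (forall i j : int, x *~ i + y *~ j = 0 -> i = 0 /\ j = 0).
Proof.
split=> [bb|[gen free] v].
  split=> [v|i j ij0].
    exists (intcoord [tuple x; y] v 0 0), (intcoord [tuple x; y] v 0 1).
    by rewrite -{1}(intcoordK v bb) intcombE.
  have e : intcomb [tuple x; y] (\row_k (if k == 0 then i else j)) = intcomb [tuple x; y] 0.
    by rewrite !intcombE !mxE /= ij0 !mulr0z addr0.
  have := congr1 (intcoord [tuple x; y]) e; rewrite !intcombK// => /rowP ij.
  by have := ij 0; have := ij 1; rewrite !mxE.
have [i [j ->]] := gen v; exists (\row_k (if k == 0 then i else j)); split.
  by rewrite intcombE !mxE.
move=> c; rewrite intcombE /= => e.
have [|ci cj] := free (i - c 0 0) (j - c 0 1).
  by rewrite !mulrzBr addrACA e -opprD subrr.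
apply/rowP => k; rewrite !mxE; by elim/ord2P: k => /=; apply: subr0_eq.
Qed.

Lemma Zbasis_rot x y : Zbasis [tuple x; y] -> Zbasis [tuple - y; x].
Proof.
move=> /ZbasisP[gen free]; apply/ZbasisP; split=> [v|i j].
  by have [i [j ->]] := gen v; exists (- j), i; rewrite mulrNz mulNrz opprK addrC.
by rewrite mulNrz -mulrNz addrC => /free[-> /eqP]; rewrite oppr_eq0 => /eqP.
Qed.

Lemma Zbasis_shear x y (n : int) : Zbasis [tuple x; y] -> Zbasis [tuple x; y + x *~ n].
Proof.
move=> /ZbasisP[gen free]; apply/ZbasisP; split=> [v|i j].
  have [i [j ->]] := gen v; exists (i - n * j), j.
  by rewrite mulrzBr mulrzDl mulrzA [y *~ j + _]addrC addrA addrNK.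
rewrite mulrzDl -mulrzA addrCA addrC -mulrzDr => /free[e j0]; split=> //.
by move: e; rewrite j0 mulr0 addr0.
Qed.

Lemma Zbasis_addl x y : Zbasis [tuple x; y] -> Zbasis [tuple x + y; y].
Proof.
move=> /ZbasisP[gen free]; apply/ZbasisP; split=> [v|i j].
  have [i [j ->]] := gen v; exists i, (j - i).
  by rewrite mulrzDl mulrzBr -addrA [y *~ i + _]addrC subrK.
by rewrite mulrzDl -addrA -mulrzDr => /free[-> /eqP]; rewrite add0r => /eqP.
Qed.

Lemma linmapD b b' : Zbasis b -> {morph linmap b b' : x y / x + y}.
Proof. by move=> bb x y; rewrite /linmap intcoordD// intcombD. Qed.

Lemma linmap_tnth b b' i : Zbasis b -> linmap b b' (tnth b i) = tnth b' i.
Proof.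
move=> bb; rewrite /linmap intcoord_tnth// intcombE !mxE.
by elim/ord2P: i; rewrite /= ?mulr0z ?mulr1z ?addr0 ?add0r.
Qed.

Lemma linmapK b b' : Zbasis b -> Zbasis b' -> cancel (linmap b b') (linmap b' b).
Proof. by move=> bb bb' x; rewrite /linmap intcombK// intcoordK. Qed.

Lemma linmap_bij b b' : Zbasis b -> Zbasis b' -> bijective (linmap b b').
Proof. by move=> bb bb'; exists (linmap b' b); exact: linmapK. Qed.

End ZBases.

Section Morphisms.
Context (L : zmodType) (g : L -> L) (gD : {morph g : x y / x + y}).

Lemma morphD0 : g 0 = 0.
Proof. by apply: (addrI (g 0)); rewrite -gD !addr0. Qed.

Lemma morphDN x : g (- x) = - g x.
Proof. by apply: (addrI (g x)); rewrite -gD !subrr morphD0. Qed.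

Lemma morphDMz x (n : int) : g (x *~ n) = g x *~ n.
Proof.
have gMn k : g (x *+ k) = g x *+ k by elim: k => [|k IH]; rewrite ?mulr0n ?morphD0// !mulrS gD IH.
by case: n => n; rewrite ?NegzE ?mulrNz ?morphDN -!pmulrn gMn.
Qed.

Lemma morphD_intcomb (b : 2.-tuple L) c :
  g (intcomb b c) = g (tnth b 0) *~ c 0 0 + g (tnth b 1) *~ c 0 1.
Proof. by rewrite intcombE gD !morphDMz. Qed.

Context (gbij : bijective g).

Lemma morphD_inv h : cancel h g -> {morph h : x y / x + y}.
Proof. by move=> hK x y; apply: (bij_inj gbij); rewrite gD !hK. Qed.

Lemma Zbasis_morph (b : 2.-tuple L) : Zbasis b -> Zbasis (map_tuple g b).
Proof.
move=> bb x; have [h gK hK] := gbij; have [c [hc uc]] := bb (h x).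
exists c; split=> [|d xd]; first by rewrite -[x]hK hc morphD_intcomb intcombE !tnth_map.
by apply: uc; apply: (bij_inj gbij); rewrite hK xd morphD_intcomb intcombE !tnth_map.
Qed.

Lemma primitive_morph v : primitive v -> primitive (g v).
Proof.
move=> [K [Kz gen dir]]; have [h gK hK] := gbij; have hD := morphD_inv hK.
exists (fun x => h x \in K); split=> [|x|n].
- split; first by rewrite unfold_in /= -morphD0 gK Kz.1.
  move=> x y; rewrite !unfold_in /= => xK yK.
  have -> : h (x - y) = h x - h y.
    by apply: (addIr (h y)); rewrite -hD !addrNK.
  exact: Kz.2.
- have [n [k [kK hx]]] := gen (h x); exists n, (g k); split; first by rewrite unfold_in /= gK.
  by rewrite -[LHS]hK hx gD morphDMz.
- by rewrite unfold_in /= -morphDMz gK => /dir ->; exact: morphD0.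
Qed.

End Morphisms.

Lemma morphD_eq (L : zmodType) (g h : L -> L) (b : 2.-tuple L) : Zbasis b ->
  {morph g : x y / x + y} -> {morph h : x y / x + y} ->
  (forall i, g (tnth b i) = h (tnth b i)) -> g =1 h.
Proof.
by move=> bb gD hD gh v; rewrite -(intcoordK v bb) !morphD_intcomb// !gh.
Qed.

(** * Components of the cones *)

(** A linear form without zeros on [A] has constant sign on each connected subset of [A], and a
convex half of [A] is connected; so the half on which the form is positive is a component. *)
Lemma connected_component_halfspace (R : realType) (A : set 'rV[R]_2) (c : 'cV[R]_2)
    (x : 'rV[R]_2) (f := fun y : 'rV[R]_2 => (y *m c) 0 0) :
  (forall y, A y -> f y != 0) ->
  (forall y z t, A y -> A z -> 0 < f y -> 0 < f z -> 0 <= t <= 1 -> A (y + t *: (z - y))) ->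
  A x -> 0 < f x -> connected_component A x = A `&` [set y | 0 < f y].
Proof.
move=> fA convA Ax fx.
have fcont : continuous f.
  have -> : f = fun y => y 0 0 * c 0 0 + y 0 1 * c 1 0.
    by apply/funext => y; rewrite /f mxE sum2.
  move=> y; apply: (@cvgD _ _ _ (nbhs y) _ (fun y : 'rV[R]_2 => y 0 0 * c 0 0)
    (fun y : 'rV[R]_2 => y 0 1 * c 1 0)).
    by apply: (@cvgM _ _ (nbhs y) _ (fun y : 'rV[R]_2 => y 0 0) (fun=> c 0 0));
      [exact: coord_continuous | exact: cvg_cst].
  by apply: (@cvgM _ _ (nbhs y) _ (fun y : 'rV[R]_2 => y 0 1) (fun=> c 1 0));
    [exact: coord_continuous | exact: cvg_cst].
apply/seteqP; split=> [y Cy|y [Ay fy]].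
  have Ay := connected_component_sub Cy; split=> //=; rewrite ltNge; apply/negP => fy.
  have /connected_intervalP fC : connected (f @` connected_component A x).
    apply: connected_continuous_connected; first exact: component_connected.
    exact: continuous_subspaceT.
  have [z Cz fz0] : (f @` connected_component A x) 0.
    apply: (fC (f y) (f x)); [by exists y | | by rewrite fy (ltW fx)].
    by exists x => //; exact: connected_component_refl.
  by have := fA z (connected_component_sub Cz); rewrite fz0 eqxx.
pose s := fun t : R => x + t *: (y - x).
exists (s @` `[0, 1]).
  split.
  - by exists 0; [rewrite /= in_itv /= lexx ler01 | rewrite /s scale0r addr0].
  - by move=> _ [t t01 <-]; apply: convA => //; move: t01; rewrite /= in_itv.
  - apply: connected_continuous_connected; first exact: segment_connected.
    apply: continuous_subspaceT => t.
    apply: (@cvgD _ _ _ (nbhs t) _ (fun=> x) (fun t => t *: (y - x))); first exact: cvg_cst.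
    by apply: (@cvgZ _ _ _ (nbhs t) _ id (fun=> y - x)); [exact: cvg_id | exact: cvg_cst].
by exists 1; [rewrite /= in_itv /= lexx ler01 | rewrite /s scale1r addrC subrK].
Qed.

(** * The form over the reals and its null coordinates *)

Lemma det_mx2 (K : comNzRingType) (A : 'M[K]_2) :
  \det A = A 0 0 * A 1 1 - A 0 1 * A 1 0.
Proof.
rewrite (expand_det_row _ 0) sum2 /cofactor !det_mx11 !mxE /= expr0 expr1 mul1r.
rewrite (_ : lift 0 0 = 1); last exact: val_inj.
rewrite (_ : lift 1 0 = 0); last exact: val_inj.
by rewrite mulN1r mulrN.
Qed.

Section RealPlane.
Context (R : realType) (L : lorentzian2).
Implicit Types (v w : L) (x y : 'rV[R]_2) (N : 'M[R]_2) (g : L -> L).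

Let e := refbasis L.

Lemma Zbasis_refbasis : Zbasis (refbasis L).
Proof. by rewrite /refbasis; case: cid. Qed.

Lemma toP_is_additive : zmod_morphism (@toP R L).
Proof.
move=> v w; rewrite /toP -map_mxB; congr map_mx.
by apply: (addIr (intcoord e w)); rewrite -intcoordD ?addrNK//; exact: Zbasis_refbasis.
Qed.
HB.instance Definition _ := GRing.isZmodMorphism.Build L 'rV[R]_2 (@toP R L) toP_is_additive.

Lemma toP_refbasis i : toP R (tnth e i) = delta_mx 0 i.
Proof. by rewrite /toP intcoord_tnth ?map_delta_mx//; exact: Zbasis_refbasis. Qed.

Lemma toP_refcoord v : toP R v = \row_i (intcoord e v 0 i)%:~R.
Proof. by apply/rowP => i; rewrite !mxE. Qed.

Lemma toP_endo g v : {morph g : x y / x + y} -> toP R (g v) = endoP g (toP R v).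
Proof.
move=> gD; rewrite /endoP /toP -map_mxM; congr map_mx.
have re := Zbasis_refbasis.
rewrite -[RHS](intcombK _ re). congr (intcoord _ _).
rewrite -{1}(intcoordK v re) (morphD_intcomb gD) intcombE.
have gE i : g (tnth e i) = intcomb e (row i (endo_mx g)).
  by rewrite rowK intcoordK.
rewrite !gE !intcombE !mxE !sum2 !mulrzDl !mulrzDr -!mulrzA.
by rewrite addrACA !mxE ![intcoord _ (g _) _ _ * _]mulrC.
Qed.

Lemma row_endo g i : row i (map_mx intr (endo_mx g)) = toP R (g (tnth e i)).
Proof. by rewrite -map_row rowK. Qed.

Lemma dot0 w : dot 0 w = 0 :> rat.
Proof. by apply: (addrI (dot (0 : L) w)); rewrite -dotDl !addr0. Qed.

Lemma dotNl v w : dot (- v) w = - dot v w.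
Proof. by apply: (addrI (dot v w)); rewrite -dotDl !subrr dot0. Qed.

Lemma dotMzl v w (n : int) : dot (v *~ n) w = dot v w * n%:~R.
Proof.
have dMn k : dot (v *+ k) w = dot v w * k%:R.
  by elim: k => [|k IH]; rewrite ?mulr0n ?mulr0 ?dot0// mulrS dotDl IH mulrSr mulrDr mulr1 addrC.
case: n => n; first by rewrite -pmulrn dMn.
by rewrite NegzE !mulrNz mulrN dotNl -pmulrn dMn.
Qed.

Lemma dot_intcomb c d : dot (intcomb e c) (intcomb e d) =
  \sum_(i < 2) \sum_(j < 2) (c 0 i)%:~R * (d 0 j)%:~R * gram (@dot L) e i j.
Proof.
rewrite !sum2 !intcombE !mxE dotDl !dotMzl ![dot _ (_ + _)]dot_sym !dotDl !dotMzl.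
by rewrite [dot (tnth e 1) (tnth e 0)]dot_sym; ring.
Qed.

Lemma dotP_toP v w : dotP L (toP R v) (toP R w) = ratr (dot v w).
Proof.
rewrite -{2}(intcoordK v Zbasis_refbasis) -{2}(intcoordK w Zbasis_refbasis).
rewrite dot_intcomb /dotP !toP_refcoord !mxE !sum2 !mxE !sum2 !mxE.
by rewrite !rmorphD !rmorphM /= !ratr_int; ring.
Qed.

(** The Gram matrix of the form with quadratic form [(p, m) |-> p * m]. *)
Definition nullJ : 'M[R]_2 := \matrix_(i, j) ((i != j)%:R / 2).

(** The columns of [N] are the null coordinates [p] and [m]: linear forms on the plane whose
product is the quadratic form. *)
Definition null_matrix N : Prop :=
  N \in unitmx /\ map_mx ratr (gram (@dot L) e) = N *m nullJ *m N^T.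

(** Over the rationals the form is [d0 * y0 ^+ 2 + d1 * y1 ^+ 2] with [d0 > 0 > d1]; over the
reals it factors as a difference of two squares. *)
Lemma null_matrix_exists : exists N, null_matrix N.
Proof.
have [Q [d [Qu QG d0 d1]]] := dot_signature Zbasis_refbasis.
pose a : R := Num.sqrt (ratr (d 0 0)); pose b : R := Num.sqrt (- ratr (d 0 1)).
have a2 : ratr (d 0 0) = a ^+ 2 by rewrite sqr_sqrtr// ler0q ltW.
have b2 : ratr (d 0 1) = - b ^+ 2 by rewrite sqr_sqrtr ?opprK// oppr_ge0 lerq0 ltW.
have a0 : 0 < a by rewrite sqrtr_gt0 ltr0q.
have b0 : 0 < b by rewrite sqrtr_gt0 oppr_gt0 ltrq0.
pose K : 'M[R]_2 := \matrix_(i, j) (if i == 0 then a else if j == 0 then - b else b).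
have Ku : K \in unitmx.
  rewrite unitmxE det_mx2 !mxE /= unitfE; apply: lt0r_neq0.
  by rewrite mulrN opprK addr_gt0 ?mulr_gt0.
have KJ : K *m nullJ *m K^T = diag_mx (map_mx ratr d).
  apply/matrixP => i j; elim/ord2P: i; elim/ord2P: j;
    rewrite !mxE !sum2 !mxE !sum2 !mxE /= ?mulr1n ?mulr0n ?a2 ?b2; by field.
have Qu' : (map_mx ratr Q : 'M[R]_2) \in unitmx by rewrite map_unitmx.
set Q' : 'M[R]_2 := map_mx ratr Q in Qu' *.
exists (invmx Q' *m K); split; first by rewrite unitmx_mul unitmx_inv Qu' Ku.
rewrite trmx_mul mulmxA -[_ *m nullJ]mulmxA -[invmx Q' *m _ *m K^T]mulmxA KJ -map_diag_mx -QG.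
rewrite !map_mxM -map_trmx -/Q' !mulmxA mulVmx// mul1mx -mulmxA trmx_inv mulmxV ?mulmx1//.
by rewrite unitmx_tr.
Qed.

End RealPlane.

Section NullMatrices.
Context (R : realType) (L : lorentzian2).
Implicit Types (v w : L) (x y : 'rV[R]_2) (N : 'M[R]_2) (g : L -> L).

Let e := refbasis L.

Definition coord N (i : 'I_2) v : R := (toP R v *m N) 0 i.

Lemma coord_is_additive N i : zmod_morphism (coord N i).
Proof. by move=> v w; rewrite /coord raddfB mulmxBl !mxE. Qed.
HB.instance Definition _ N i := GRing.isZmodMorphism.Build L R (coord N i) (coord_is_additive N i).

(** A hyperbolic rotation of the plane that preserves the lattice. *)
Definition boost (p m : L -> R) (t : R) g : Prop :=
  [/\ {morph g : x y / x + y}, bijective g, 0 < t,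
      forall v, p (g v) = t * p v & forall v, m (g v) = t^-1 * m v].

Lemma dotP_null N x y : null_matrix L N -> dotP L x y =
  ((x *m N) 0 0 * (y *m N) 0 1 + (x *m N) 0 1 * (y *m N) 0 0) / 2.
Proof.
move=> [_ G]; rewrite /dotP G !mulmxA -[_ *m N^T *m _]mulmxA -trmx_mul.
by move: (x *m N) (y *m N) => u w; rewrite !mxE sum2 !mxE !sum2 !mxE /=; field.
Qed.

Lemma null_matrixN N : null_matrix L N -> null_matrix L (- N).
Proof.
move=> [Nu G]; split; first by rewrite -scaleN1r unitmxZ// unitrN1.
by rewrite G mulNmx raddfN /= mulNmx mulmxN opprK.
Qed.

Definition swapmx : 'M[R]_2 := \matrix_(i, j) (i != j)%:R.

Lemma det_swapmx : \det swapmx = -1.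
Proof. by rewrite det_mx2 !mxE /= mulr0 mulr1 sub0r. Qed.

Lemma null_matrix_swap N : null_matrix L N -> null_matrix L (N *m swapmx).
Proof.
move=> [Nu G]; split.
  by rewrite unitmx_mul Nu unitmxE det_swapmx unitrN1.
rewrite G trmx_mul !mulmxA -[N *m swapmx *m _]mulmxA -[N *m _ *m swapmx^T]mulmxA.
congr (_ *m _ *m _); apply/matrixP => i j.
by elim/ord2P: i; elim/ord2P: j; rewrite !mxE !sum2 !mxE !sum2 !mxE /=; ring.
Qed.

Lemma convex_gt0 (a b t : R) : 0 < a -> 0 < b -> 0 <= t <= 1 -> 0 < a + t * (b - a).
Proof. by move=> a0 b0 /andP[t0 t1]; nra. Qed.

Lemma convex_ge0 (a b t : R) : 0 <= a -> 0 <= b -> 0 <= t <= 1 -> 0 <= a + t * (b - a).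
Proof. by move=> a0 b0 /andP[t0 t1]; nra. Qed.

Lemma null_inj N x : null_matrix L N -> x *m N = 0 -> x = 0.
Proof. by move=> [Nu _] xN; rewrite -[x](mulmxK Nu) xN mul0mx. Qed.

Lemma segmentE k (N : 'M[R]_(2, k)) x y (t : R) i :
  ((x + t *: (y - x)) *m N) 0 i = (x *m N) 0 i + t * ((y *m N) 0 i - (x *m N) 0 i).
Proof. by rewrite mulmxDl -scalemxAl mulmxBl !mxE. Qed.

Lemma rV2_neq0 x : x != 0 -> x 0 0 = 0 -> x 0 1 = 0 -> False.
Proof. by move=> /eqP + x0 x1; apply; apply/rowP; elim/ord2P; rewrite mxE. Qed.

(** The form [p + m] separates the two components: it has no zero on the nonzero vectors with
[p * m >= 0]. *)
Lemma nonneg_component N x : null_matrix L N ->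
  nonneg_vectors R L x -> 0 < (x *m N) 0 0 + (x *m N) 0 1 ->
  connected_component (nonneg_vectors R L) x =
    [set y | [/\ y != 0, 0 <= (y *m N) 0 0 & 0 <= (y *m N) 0 1]].
Proof.
move=> Nn Ax fx; pose c : 'cV[R]_2 := N *m const_mx 1.
have fE y : (y *m c) 0 0 = (y *m N) 0 0 + (y *m N) 0 1.
  by rewrite mulmxA mxE sum2 !mxE !mulr1.
have AE y : nonneg_vectors R L y <-> y != 0 /\ 0 <= (y *m N) 0 0 * (y *m N) 0 1.
  rewrite /nonneg_vectors /= (dotP_null _ _ Nn) [_ 0 1 * _ 0 0]mulrC -mulr2n -[X in X / 2]mulr_natr.
  by rewrite mulfK// pnatr_eq0.
have Npos y : nonneg_vectors R L y -> 0 < (y *m c) 0 0 ->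
    0 <= (y *m N) 0 0 /\ 0 <= (y *m N) 0 1.
  by move=> /AE[_]; rewrite fE; split; nra.
have Nge y : y != 0 -> 0 <= (y *m N) 0 0 -> 0 <= (y *m N) 0 1 -> 0 < (y *m c) 0 0.
  move=> y0 y1 y2; rewrite fE lt_neqAle addr_ge0// andbT eq_sym paddr_eq0//.
  apply/negP => /andP[/eqP e1 /eqP e2]; apply: (@rV2_neq0 (y *m N)) => //.
  by apply: contra_neq y0; exact: null_inj.
rewrite (@connected_component_halfspace _ _ c)//.
- apply/seteqP; split=> y /= => [[Ay fy]|[y0 y1 y2]].
    by have [? ?] := Npos _ Ay fy; split=> //; have [] := (AE y).1 Ay.
  by split; [apply/AE; rewrite mulr_ge0 | exact: Nge].
- move=> y /AE[y0 yy]; rewrite fE; apply/eqP => e0.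
  apply: (@rV2_neq0 (y *m N)); first by apply: contra_neq y0; exact: null_inj.
    nra.
  nra.
- move=> y z t Ay Az fy fz t01.
  have [y1 y2] := Npos _ Ay fy; have [z1 z2] := Npos _ Az fz.
  have := convex_gt0 fy fz t01; rewrite -segmentE => fs.
  apply/AE; split; last by rewrite !segmentE mulr_ge0// convex_ge0.
  by apply: contraTneq fs => ->; rewrite mul0mx mxE ltxx.
- by rewrite fE.
Qed.

(** Here [p - m] plays the role of the separating form. *)
Lemma neg_component N x : null_matrix L N ->
  0 < (x *m N) 0 0 -> (x *m N) 0 1 < 0 ->
  connected_component (neg_vectors R L) x =
    [set y | 0 < (y *m N) 0 0 /\ (y *m N) 0 1 < 0].
Proof.
move=> Nn x1 x2; pose c : 'cV[R]_2 := N *m \col_i (if i == 0 then 1 else -1).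
have fE y : (y *m c) 0 0 = (y *m N) 0 0 - (y *m N) 0 1.
  by rewrite mulmxA mxE sum2 !mxE /= mulr1 mulrN1.
have AE y : neg_vectors R L y <-> (y *m N) 0 0 * (y *m N) 0 1 < 0.
  rewrite /neg_vectors /= (dotP_null _ _ Nn) [_ 0 1 * _ 0 0]mulrC -mulr2n -[X in X / 2]mulr_natr.
  by rewrite mulfK// pnatr_eq0.
have Npos y : neg_vectors R L y -> 0 < (y *m c) 0 0 ->
    0 < (y *m N) 0 0 /\ 0 < - (y *m N) 0 1.
  by move=> /AE; rewrite fE; split; nra.
rewrite (@connected_component_halfspace _ _ c)//.
- apply/seteqP; split=> y /= => [[Ay fy]|[y1 y2]].
    by have [? ?] := Npos _ Ay fy; split=> //; rewrite -oppr_gt0.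
  by split; [apply/AE; nra | rewrite fE; lra].
- by move=> y /AE yy; rewrite fE; apply/eqP => e0; nra.
- move=> y z t Ay Az fy fz t01.
  have [y1 y2] := Npos _ Ay fy; have [z1 z2] := Npos _ Az fz.
  apply/AE; rewrite !segmentE; have := convex_gt0 y1 z1 t01; have := convex_gt0 y2 z2 t01.
  nra.
- by apply/AE; nra.
- by rewrite fE; lra.
Qed.

End NullMatrices.

(** * SO-up is the group of boosts *)

Section Boosts.
Context (R : realType) (L : lorentzian2).
Implicit Types (v w : L) (x y : 'rV[R]_2) (N : 'M[R]_2) (g : L -> L).

Let e := refbasis L.

Lemma norm2_coord N v : null_matrix L N -> ratr (norm2 v) = coord N 0 v * coord N 1 v.
Proof. by move=> Nn; rewrite -dotP_toP (dotP_null _ _ Nn) /coord; field. Qed.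

Lemma dot_polarization v w : dot v w = (norm2 (v + w) - norm2 v - norm2 w) / 2.
Proof.
by rewrite /norm2 dotDl ![dot _ (v + w)]dot_sym !dotDl [dot w v]dot_sym; field.
Qed.

Lemma boost_dot (p m : {additive L -> R}) t g :
  (forall v, ratr (norm2 v) = p v * m v) -> boost p m t g ->
  forall v w, dot (g v) (g w) = dot v w.
Proof.
move=> nE [gD _ t0 gp gm] v w.
have gn u : norm2 (g u) = norm2 u.
  apply: (fmorph_inj (ratr : {rmorphism rat -> R})).
  by rewrite /= !nE gp gm mulrACA mulfV ?mul1r// gt_eqF.
by rewrite !dot_polarization -gD !gn.
Qed.

Lemma coord_refbasis N (i j : 'I_2) : coord N j (tnth e i) = N i j.
Proof. by rewrite /coord toP_refbasis -rowE mxE. Qed.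

Lemma coord_endo N g v i : {morph g : x y / x + y} ->
  coord N i (g v) = (endoP g (toP R v) *m N) 0 i.
Proof. by move=> gD; rewrite /coord toP_endo. Qed.

(** In null coordinates the real extension of a boost is the diagonal matrix with entries [t] and
[t^-1], which has determinant 1 and keeps the signs of both coordinates. *)
Lemma boost_SOup N t g : null_matrix L N ->
  boost (coord N 0) (coord N 1) t g -> SOup R g.
Proof.
move=> Nn bg; have [gD gbij t0 gp gm] := bg; have [Nu _] := Nn.
pose F : 'M[R]_2 := diag_mx (\row_i (if i == 0 then t else t^-1)).
pose E : 'M[R]_2 := map_mx intr (endo_mx g).
have EN : E *m N = N *m F.
  apply/matrixP => i j.
  have -> : (E *m N) i j = coord N j (g (tnth e i)).
    by rewrite /coord -row_endo -row_mul [RHS]mxE.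
  by elim/ord2P: j; rewrite ?gp ?gm coord_refbasis !mxE sum2 !mxE /= ?mulr1n ?mulr0n; ring.
have dE : \det (endo_mx g) = 1.
  apply: (@intr_inj R); rewrite -det_map_mx rmorph1 -/E.
  have : \det (E *m N) = \det N * 1.
    by rewrite EN det_mulmx det_diag big_ord_recl big_ord1 !mxE /= mulfV ?gt_eqF.
  by rewrite det_mulmx mulrC => /(mulfI _)->//; rewrite -unitfE -unitmxE.
have Eu : E \in unitmx by rewrite unitmxE det_map_mx dE rmorph1 unitr1.
have gP x : (endoP g x *m N) 0 0 = t * (x *m N) 0 0 /\
            (endoP g x *m N) 0 1 = t^-1 * (x *m N) 0 1.
  rewrite /endoP -/E -mulmxA EN mulmxA; move: (x *m N) => u.
  by rewrite !mxE !sum2 !mxE /= ?mulr1n ?mulr0n; split; ring.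
split=> //; first by split=> //; apply: boost_dot bg => v; exact: norm2_coord.
have key C : (forall x, C (endoP g x) <-> C x) -> endoP g @` C = C.
  move=> gC; apply/seteqP; split=> [_ [x Cx <-]|x Cx]; first exact/gC.
  have xE : endoP g (x *m invmx E) = x by rewrite /endoP mulmxKV.
  by exists (x *m invmx E) => //; apply/gC; rewrite xE.
move=> _ [x xneg ->].
have xpm : (x *m N) 0 0 * (x *m N) 0 1 < 0.
  by move: xneg; rewrite /neg_vectors /= (dotP_null _ _ Nn); lra.
have [x0|x0|x0] := ltrgt0P ((x *m N) 0 0).
- rewrite (neg_component Nn)//; last by nra.
  by apply: key => y /=; have [-> ->] := gP y; rewrite !pmulr_rgt0 ?pmulr_rlt0 ?invr_gt0.
- have NN y i : (y *m - N) 0 i = - (y *m N) 0 i by rewrite mulmxN mxE.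
  rewrite (neg_component (null_matrixN Nn)) ?NN ?oppr_gt0 ?oppr_lt0//; last by nra.
  apply: key => y /=; rewrite !NN !oppr_gt0 !oppr_lt0; have [-> ->] := gP y.
  by rewrite !pmulr_rlt0 ?pmulr_rgt0 ?invr_gt0.
- by move: xpm; rewrite x0 mul0r ltxx.
Qed.

(** A linear substitution that preserves the product [p * m] multiplies [p] and [m] by inverse
constants or does so after exchanging them; determinant 1 excludes the exchange, and preserving
the component [p > 0 > m] makes the constants positive. *)
Lemma SOup_boost N g : null_matrix L N -> SOup R g ->
  exists t, boost (coord N 0) (coord N 1) t g.
Proof.
move=> Nn [[gD gbij gdot] dE gC]; have [Nu G] := Nn.
pose E : 'M[R]_2 := map_mx intr (endo_mx g).
have [F NF] : exists F : 'M[R]_2, N *m F = E *m N.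
  by exists (invmx N *m E *m N); rewrite !mulmxA mulmxV// mul1mx.
have EG : E *m map_mx ratr (gram (@dot L) e) *m E^T = map_mx ratr (gram (@dot L) e).
  apply/matrixP => i j; rewrite [RHS]mxE [in RHS]mxE -gdot -dotP_toP /dotP -!row_endo -/E.
  rewrite -row_mul [RHS]mxE [LHS]mxE; apply: eq_bigr => k _.
  by congr (_ * _); [rewrite [RHS]mxE | rewrite !mxE].
have FJ : F *m nullJ R *m F^T = nullJ R.
  have : N *m (F *m nullJ R *m F^T) *m N^T = N *m nullJ R *m N^T.
    transitivity ((N *m F) *m nullJ R *m (N *m F)^T); first by rewrite trmx_mul !mulmxA.
    by rewrite NF trmx_mul -[RHS]G -[RHS]EG G !mulmxA.
  have Ntu : N^T \in unitmx by rewrite unitmx_tr.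
  by move=> /(congr1 (fun A => invmx N *m A *m invmx N^T)); rewrite !mulmxA !mulmxK// !mulVmx// !mul1mx.
have dF : \det F = 1.
  have := congr1 determinant NF.
  rewrite !det_mulmx det_map_mx dE rmorph1 mul1r -[RHS]mulr1; apply: mulfI.
  by rewrite -unitfE -unitmxE.
have F00 := congr1 (fun A : 'M[R]_2 => A 0 0) FJ.
have F01 := congr1 (fun A : 'M[R]_2 => A 0 1) FJ.
have F11 := congr1 (fun A : 'M[R]_2 => A 1 1) FJ.
have F10 : F 0 1 = 0 /\ F 1 0 = 0 /\ F 0 0 * F 1 1 = 1.
  move: F00 F01 F11 dF; rewrite det_mx2 !mxE !sum2 !mxE !sum2 !mxE /=.
  move: (F 0 0) (F 0 1) (F 1 0) (F 1 1) => a b c d h1 h2 h3 h4.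
  have h5 : a * d = 1 by lra.
  have h6 : b * c = 0 by lra.
  have h7 : a * b = 0 by lra.
  have h8 : c * d = 0 by lra.
  split; first by rewrite -[b]mul1r -h5 mulrAC h7 mul0r.
  by split=> //; rewrite -[c]mulr1 -h5 mulrCA h8 mulr0.
have [f01 [f10 f11]] := F10.
have gP x : (endoP g x *m N) 0 0 = F 0 0 * (x *m N) 0 0 /\
            (endoP g x *m N) 0 1 = F 1 1 * (x *m N) 0 1.
  rewrite /endoP -/E -mulmxA -NF mulmxA; move: (x *m N) => u.
  by rewrite !mxE !sum2 f01 f10; split; ring.
have t0 : 0 < F 0 0.
  (* [x] is the vector with null coordinates (1, -1). *)
  pose x := (\row_i (if i == 0 then 1 else -1)) *m invmx N.
  have x0 : (x *m N) 0 0 = 1 by rewrite mulmxKV// mxE.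
  have x1 : (x *m N) 0 1 = -1 by rewrite mulmxKV// mxE.
  have xneg : neg_vectors R L x.
    by rewrite /neg_vectors /= (dotP_null _ _ Nn) x0 x1; lra.
  have /seteqP[+ _] := gC _ (ex_intro2 _ _ x xneg erefl).
  rewrite (neg_component Nn) ?x0 ?x1 ?ltr01 ?ltrN10//.
  move=> /(_ (endoP g x))[]; first by exists x => //=; rewrite x0 x1 ltr01 ltrN10.
  by have [-> _] := gP x; rewrite x0 mulr1.
exists (F 0 0); split=> // v; rewrite coord_endo//; have [e0 e1] := gP (toP R v) => //.
by rewrite e1; congr (_ * _); apply: (mulfI (lt0r_neq0 t0)); rewrite f11 mulfV ?gt_eqF.
Qed.

End Boosts.

(** The determinant of [(v, w)] in null coordinates. *)
Definition area (R : realType) (L : lorentzian2) (p m : L -> R) (v w : L) : R :=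
  p v * m w - m v * p w.

(** All that the rest of the proof uses of the real plane.  The positivity in [nc_S] is strict
because an anisotropic lattice has no nonzero vector on the null lines. *)
Record null_coordinates (R : realType) (L : lorentzian2) (S : set 'rV[R]_2)
    (o : 'M[R]_2) (p m : {additive L -> R}) : Prop := NullCoordinates {
  nc_norm : forall v, ratr (norm2 v) = p v * m v;
  nc_S : forall v, S (toP R v) <-> 0 < p v /\ 0 < m v;
  nc_oriented : forall v w, oriented o (toP R v) (toP R w) <-> 0 < area p m v w;
  nc_SOup : forall g : L -> L, SOup R g <-> exists t, boost p m t g
}.

Lemma orientedE (R : realType) (o N : 'M[R]_2) (x y : 'rV[R]_2) :
  o \in unitmx -> N \in unitmx -> 0 < \det o * \det N ->
  oriented o x y <->
  0 < (x *m N) 0 0 * (y *m N) 0 1 - (x *m N) 0 1 * (y *m N) 0 0.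
Proof.
move=> ou Nu oN; rewrite /oriented; set A := \matrix_(i < 2) _.
have -> : (x *m N) 0 0 * (y *m N) 0 1 - (x *m N) 0 1 * (y *m N) 0 0 = \det (A *m N).
  by rewrite det_mx2 !mxE !sum2 !mxE.
have oi0 : \det o != 0 by rewrite -unitfE -unitmxE.
rewrite !det_mulmx det_inv.
have -> : \det A * \det N = (\det A / \det o) * (\det o * \det N) by rewrite mulrA divfK.
by rewrite [X in _ <-> is_true X](pmulr_lgt0 _ oN); exact: iff_refl.
Qed.

(** The forms [p] and [m] are determined up to exchange and a common sign (and scaling): the sign
is chosen so that [S] is the positive quadrant, and the order so that [o] is positively
oriented. *)
Lemma null_coordinates_exist (R : realType) (L : lorentzian2) (S : set 'rV[R]_2)
    (o : 'M[R]_2) :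
  anisotropic L -> component (nonneg_vectors R L) S -> o \in unitmx ->
  exists p m : {additive L -> R}, null_coordinates S o p m.
Proof.
move=> aniso [x Ax SE] ou; rewrite {S}SE.
set S := connected_component _ x.
have [N [Nn NS]] : exists N, null_matrix L N /\
    S = [set y | [/\ y != 0, 0 <= (y *m N) 0 0 & 0 <= (y *m N) 0 1]].
  have [N Nn] := null_matrix_exists R L; have [x0 xx] := Ax.
  have : (x *m N) 0 0 + (x *m N) 0 1 != 0.
    apply/eqP => e0; move: xx; rewrite (dotP_null _ _ Nn) => xx.
    by apply: (@rV2_neq0 _ (x *m N)); [apply: contra_neq x0; exact: (null_inj Nn) | nra | nra].
  rewrite neq_lt => /orP[fx|fx]; last by exists N; split=> //; exact: nonneg_component.
  exists (- N); split; first exact: null_matrixN.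
  apply: nonneg_component => //; first exact: null_matrixN.
  by rewrite mulmxN mxE [(- (x *m N)) _ _]mxE -opprD oppr_gt0.
have {N Nn NS}[N [Nn NS oN]] : exists N, [/\ null_matrix L N,
    S = [set y | [/\ y != 0, 0 <= (y *m N) 0 0 & 0 <= (y *m N) 0 1]]
    & 0 < \det o * \det N].
  have [Nu _] := Nn.
  have : \det o * \det N != 0 by rewrite mulf_neq0// -unitfE -unitmxE.
  rewrite neq_lt => /orP[oN|oN]; last by exists N.
  exists (N *m swapmx R); split; first exact: null_matrix_swap.
    have sw (y : 'rV[R]_2) : (y *m (N *m swapmx R)) 0 0 = (y *m N) 0 1 /\
                (y *m (N *m swapmx R)) 0 1 = (y *m N) 0 0.
      rewrite mulmxA; move: (y *m N) => u; rewrite !mxE !sum2 !mxE /=; split; ring.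
    rewrite NS; apply/seteqP; split=> y /=; have [-> ->] := sw y; case=> ? ? ?; split=> //.
  by rewrite det_mulmx det_swapmx mulrN1 mulrN oppr_gt0.
have [Nu _] := Nn; have nE v := norm2_coord v Nn.
exists (coord N 0), (coord N 1); split=> //.
- move=> v; rewrite NS /= /coord; split=> [[v0 v1 v2]|[v1 v2]]; last first.
    split; rewrite ?ltW//; apply: contraTneq v1 => ->; rewrite mul0mx mxE ltxx//.
  have : norm2 v != 0.
    apply: contra_neq v0 => /aniso ->; exact: raddf0.
  rewrite -(fmorph_eq0 (ratr : {rmorphism rat -> R})) /= nE mulf_eq0 negb_or.
  by move=> /andP[? ?]; rewrite !lt_neqAle v1 v2 ![0 == _]eq_sym !andbT.
- move=> v w; exact: orientedE.
- move=> g; split; first exact: SOup_boost.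
  by move=> [t bg]; exact: boost_SOup Nn bg.
Qed.

(** * Boosts from equal Gram matrices *)

Section GramMatrices.
Context (R : realType) (L : lorentzian2) (S : set 'rV[R]_2) (o : 'M[R]_2).
Context (p m : {additive L -> R}).
Context (aniso : anisotropic L) (nc : null_coordinates S o p m).
Implicit Types (a b v w : L).

Lemma nc_dot v w : ratr (dot v w) = (p v * m w + m v * p w) / 2.
Proof.
rewrite dot_polarization fmorph_div !rmorphB /= !(nc_norm nc) ratr_nat !raddfD /=.
by congr (_ / _); ring.
Qed.

Lemma nc_neq0 v : v <> 0 -> p v * m v != 0.
Proof.
move=> v0; rewrite -(nc_norm nc); apply/eqP => /eqP.
by rewrite (fmorph_eq0 (ratr : {rmorphism rat -> R})) => /eqP /aniso.
Qed.

Lemma pMz v (n : int) : p (v *~ n) = p v * n%:~R.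
Proof. by rewrite raddfMz mulrzr. Qed.

Lemma mMz v (n : int) : m (v *~ n) = m v * n%:~R.
Proof. by rewrite raddfMz mulrzr. Qed.

Lemma area_lincomb a b (i j k l : int) :
  area p m (a *~ i + b *~ j) (a *~ k + b *~ l) = (i * l - j * k)%:~R * area p m a b.
Proof.
rewrite /area !(raddfD p) !(raddfD m) /= !pMz !mMz intrB !intrM; ring.
Qed.

Lemma Zbasis_neq0 a b : Zbasis [tuple a; b] -> a <> 0.
Proof.
move=> /ZbasisP[_ free] a0.
by have [] := free 1 0; rewrite ?a0 ?mul0rz ?mulr0z ?addr0.
Qed.

Lemma innermxP a b a' b' : innermx a b = innermx a' b' ->
  [/\ dot a a = dot a' a', dot a b = dot a' b' & dot b b = dot b' b'].
Proof.
move=> /matrixP e; have := e 0 0; have := e 0 1; have := e 1 1.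
by rewrite !mxE /= => -> -> ->.
Qed.

(** The Gram matrix determines the squared area, hence the area by the orientation.  Together with
the inner product, the area gives both [p a * m b] and [m a * p b], so the four coordinates are
determined up to the scaling by [t] and [t^-1]. *)
Lemma gram_boost a b a' b' :
  Zbasis [tuple a; b] -> Zbasis [tuple a'; b'] ->
  0 < area p m a b -> 0 < area p m a' b' -> 0 < p a -> 0 < p a' ->
  innermx a b = innermx a' b' ->
  boost p m (p a' / p a) (linmap [tuple a; b] [tuple a'; b']).
Proof.
move=> ab ab' D D' pa pa' /innermxP[].
move=> /(congr1 (ratr : rat -> R)) + /(congr1 (ratr : rat -> R)) + /(congr1 (ratr : rat -> R)).
rewrite !nc_dot => e1 e2 e3.
have ma : m a != 0 by have := nc_neq0 (Zbasis_neq0 ab); rewrite mulf_eq0 negb_or => /andP[].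
set t := p a' / p a; have t0 : 0 < t by rewrite divr_gt0.
have pa'E : p a' = t * p a by rewrite /t divfK ?gt_eqF.
have tV : t^-1 * t = 1 by rewrite mulVf ?gt_eqF.
have ma'E : m a' = t^-1 * m a.
  apply: (mulfI (lt0r_neq0 pa')).
  have -> : p a' * m a' = p a * m a by lra.
  by rewrite pa'E mulrACA mulfV ?mul1r ?gt_eqF.
have DE : area p m a' b' = area p m a b.
  (* The squared area is [4 * (a.b ^+ 2 - a.a * b.b)]. *)
  have : area p m a' b' ^+ 2 = area p m a b ^+ 2.
    have sqE (x y z w : R) : (x * y - z * w) ^+ 2 =
      (x * y + z * w) ^+ 2 - 4 * ((x * z) * (w * y)) by ring.
    rewrite /area !sqE.
    have -> : p a' * m b' + m a' * p b' = p a * m b + m a * p b by lra.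
    have -> : p a' * m a' = p a * m a by lra.
    by have -> : p b' * m b' = p b * m b by lra.
  by move=> /eqP; rewrite eqrXn2 ?ltW// => /eqP.
have e4 : p a' * m b' = p a * m b by move: DE e2; rewrite /area; lra.
have e5 : m a' * p b' = m a * p b by move: DE e2; rewrite /area; lra.
have mb'E : m b' = t^-1 * m b.
  apply: (mulfI (lt0r_neq0 pa')); rewrite e4 pa'E mulrACA mulfV ?mul1r ?gt_eqF//.
have pb'E : p b' = t * p b.
  apply: (mulfI ma); rewrite mulrCA -e5 ma'E; field; exact: lt0r_neq0.
have gE v : linmap [tuple a; b] [tuple a'; b'] v =
    a' *~ intcoord [tuple a; b] v 0 0 + b' *~ intcoord [tuple a; b] v 0 1.
  by rewrite /linmap intcombE.
have vE v : v = a *~ intcoord [tuple a; b] v 0 0 + b *~ intcoord [tuple a; b] v 0 1.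
  by rewrite -{1}(intcoordK v ab) intcombE.
split=> //; first exact: linmapD.
- exact: linmap_bij.
- move=> v; rewrite gE [in RHS](vE v) !raddfD /= !pMz pa'E pb'E; ring.
- move=> v; rewrite gE [in RHS](vE v) !raddfD /= !mMz ma'E mb'E; ring.
Qed.

(** Clearing the denominators of one Gram matrix makes the whole form integral. *)
Lemma dot_scaled_int : exists2 n : nat, (0 < n)%N &
  forall v w, exists z : int, n%:R * ratr (dot v w) = z%:~R :> R.
Proof.
pose G i j := gram (@dot L) (refbasis L) i j.
pose d i j := denq (G i j).
pose K := d 0 0 * d 0 1 * d 1 0 * d 1 1.
have Kpos : 0 < K by rewrite !mulr_gt0 ?denq_gt0.
have KG i j : exists z : int, K%:~R * G i j = z%:~R.
  have GE i' j' : (d i' j')%:~R * G i' j' = (numq (G i' j'))%:~R.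
    by rewrite numqE mulrC.
  elim/ord2P: i; elim/ord2P: j; rewrite /K !rmorphM /=.
  - by exists (numq (G 0 0) * d 0 1 * d 1 0 * d 1 1); rewrite !rmorphM /= -GE; ring.
  - by exists (numq (G 0 1) * d 0 0 * d 1 0 * d 1 1); rewrite !rmorphM /= -GE; ring.
  - by exists (numq (G 1 0) * d 0 0 * d 0 1 * d 1 1); rewrite !rmorphM /= -GE; ring.
  - by exists (numq (G 1 1) * d 0 0 * d 0 1 * d 1 0); rewrite !rmorphM /= -GE; ring.
move: K Kpos KG => K Kpos KG.
have [f fE] := choice (fun ij : 'I_2 * 'I_2 => KG ij.1 ij.2).
exists `|K|%N; first by rewrite absz_gt0 gt_eqF.
move=> v w; pose c := intcoord (refbasis L) v; pose c' := intcoord (refbasis L) w.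
exists (\sum_(i < 2) \sum_(j < 2) c 0 i * c' 0 j * f (i, j)).
have -> : (`|K|%N)%:R = ratr K%:~R :> R by rewrite ratr_int pmulrn gez0_abs ?ltW.
rewrite -rmorphM /= -(ratr_int R); congr ratr.
rewrite -(intcoordK v (@Zbasis_refbasis L)) -(intcoordK w (@Zbasis_refbasis L)) dot_intcomb.
rewrite mulr_sumr rmorph_sum; apply: eq_bigr => i _.
rewrite mulr_sumr rmorph_sum; apply: eq_bigr => j _.
rewrite /= !intrM -(fE (i, j)) /G /c /c' /=; ring.
Qed.

End GramMatrices.

(** * The river and the existence of a contracting boost *)

Lemma pigeonhole (T : finType) (f : nat -> T) : exists i j, (i < j)%N /\ f i = f j.
Proof.
have /injectivePn[i [j ij fij]] : ~~ injectiveb (fun i : 'I_#|T|.+1 => f i).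
  apply/negP => /injectiveP /leq_card; by rewrite card_ord ltnn.
case: (ltngtP i j) => [h|h|/val_inj e].
- by exists i, j.
- by exists j, i.
- by rewrite e eqxx in ij.
Qed.

Section RiverWalk.
Context (R : realType) (L : lorentzian2) (S : set 'rV[R]_2) (o : 'M[R]_2).
Context (p m : {additive L -> R}).
Context (aniso : anisotropic L) (nc : null_coordinates S o p m).
Implicit Types (a b v w : L).

(** An oriented basis whose cone contains the ray [p = 0], [m > 0], bounded by a vector of
positive and a vector of negative norm. *)
Definition river (ab : L * L) : Prop :=
  [/\ Zbasis [tuple ab.1; ab.2], 0 < p ab.1, 0 < m ab.1, p ab.2 < 0 & 0 < m ab.2].

(** Subtract from [l] the multiple of [r] that puts [p] of the difference [b] in the interval from
[- p r] to [0].  If [m b > 0] then [(r, b)] is on the river.  Otherwise [- b] is in [S] and has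
smaller norm than [r], and [(- b, r)] is again an oriented basis; as the norms are discrete, this
descent stops. *)
Lemma river_exists r l : Zbasis [tuple r; l] -> 0 < area p m r l -> 0 < p r -> 0 < m r ->
  exists ab, river ab.
Proof.
move=> rl D pr mr; have [n n0 nint] := dot_scaled_int R L.
have [k nk] : exists k : nat, n%:R * (p r * m r) < k%:R.
  exists (Num.bound (n%:R * (p r * m r))); apply: archi_boundP.
  exact: mulr_ge0 (ler0n _ _) (ltW (mulr_gt0 pr mr)).
elim: k r l rl D pr mr nk => [|k IH] r l rl D pr mr nk.
  by have := mulr_ge0 (ler0n R n) (ltW (mulr_gt0 pr mr)); rewrite leNgt nk.
pose q := Num.floor (p l / p r) + 1.
pose b := l + r *~ (- q).
have rb : Zbasis [tuple r; b] := Zbasis_shear _ rl.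
have br := Zbasis_rot rb.
have b0 : b <> 0 by move=> b0; apply: (Zbasis_neq0 br); rewrite b0 oppr0.
have := nc_neq0 aniso nc b0; rewrite mulf_eq0 negb_or => /andP[pb0 mb0].
have pbE : p b = p l - p r * q%:~R by rewrite /b raddfD /= pMz mulrNz mulrN.
have mbE : m b = m l - m r * q%:~R by rewrite /b raddfD /= mMz mulrNz mulrN.
have Db : area p m r b = area p m r l by rewrite /area pbE mbE; ring.
have qlt : p l < p r * q%:~R by rewrite mulrC -ltr_pdivrMr// floorD1_gt.
have qge : p r * q%:~R - p r <= p l.
  rewrite -[X in _ - X]mulr1 -mulrBr mulrC -ler_pdivlMr// /q intrD addrK.
  exact: floor_le.
have pb : p b < 0 by rewrite pbE; lra.
have pbr : - p b <= p r by rewrite pbE; lra.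
have [mb|mb] := ltP 0 (m b); first by exists (r, b).
have {mb0}mb : m b < 0 by rewrite lt_neqAle mb0.
have pNb : p (- b) = - p b by rewrite raddfN.
have mNb : m (- b) = - m b by rewrite raddfN.
apply: (IH (- b) r) => //; rewrite ?pNb ?mNb ?oppr_gt0//.
  by move: Db D; rewrite /area pNb mNb; lra.
have Db0 : 0 < area p m r b by rewrite Db.
have dec : p b * m b < p r * m r.
  have : - m b * p r < m r * - p b by move: Db0; rewrite /area; lra.
  by nra.
have [z zE] := nint b b; have [z' z'E] := nint r r.
rewrite -!/(norm2 _) !(nc_norm nc) in zE z'E.
have : (z < z')%R.
  by rewrite -(ltr_int R) -zE -z'E ltr_pM2l ?ltr0n.
rewrite -lezD1 -(ler_int R) intrD -zE -z'E => h.
rewrite mulrNN; move: nk; rewrite -natr1; lra.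
Qed.

Definition river_step (ab : L * L) : L * L :=
  if 0 < p (ab.1 + ab.2) then (ab.1 + ab.2, ab.2) else (ab.1, ab.1 + ab.2).

Lemma river_stepP ab : river ab ->
  [/\ river (river_step ab),
      area p m (river_step ab).1 (river_step ab).2 = area p m ab.1 ab.2
    & p (river_step ab).1 - p (river_step ab).2 < p ab.1 - p ab.2].
Proof.
case: ab => a b [/= ab pa ma pb mb]; rewrite /river_step /=.
have pE : p (a + b) = p a + p b by rewrite raddfD.
have mE : m (a + b) = m a + m b by rewrite raddfD.
case: ifPn => h /=.
  split; rewrite /area ?pE ?mE; [split=> //=; rewrite ?mE ?addr_gt0// | ring | lra].
  exact: Zbasis_addl.
have ab' : Zbasis [tuple a; a + b].
  by have := Zbasis_shear 1 ab; rewrite mulr1z addrC.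
split; rewrite /area ?pE ?mE; [split=> //=; rewrite ?mE ?addr_gt0// | ring | lra].
have ab0 : a + b <> 0.
  by move=> e0; apply: (Zbasis_neq0 (Zbasis_rot ab')); rewrite e0 oppr0.
have := nc_neq0 aniso nc ab0; rewrite mulf_eq0 negb_or => /andP[pab0 _].
by rewrite lt_neqAle pab0 leNgt.
Qed.

(** For the scaled integral Gram entries [x], [y], [z] of a river basis, [y ^+ 2 - x * z] is a
constant and [x > 0 > z], so the absolute values of all three integers are at most this constant.
By the pigeonhole principle two bases of the walk have the same Gram matrix. *)
Lemma contracting_boost_exists r l :
  Zbasis [tuple r; l] -> 0 < area p m r l -> 0 < p r -> 0 < m r ->
  exists (t : R) (g : L -> L), boost p m t g /\ t < 1.
Proof.
move=> rl D pr mr; have [ab0 r0] := river_exists rl D pr mr.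
pose s i := iter i river_step ab0; pose a i := (s i).1; pose b i := (s i).2.
have sr i : river (s i) by elim: i => //= i /river_stepP[].
have sA i : area p m (a i) (b i) = area p m ab0.1 ab0.2.
  by elim: i => //= i <-; have [_ -> _] := river_stepP (sr i).
have sdec i j : (i < j)%N -> p (a j) - p (b j) < p (a i) - p (b i).
  apply: (@homo_ltn _ (fun i => p (a i) - p (b i)) (fun x y => y < x)).
    by move=> x y z xy yz; apply: lt_trans xy.
  by move=> k; have [] := river_stepP (sr k).
have [n n0 nint] := dot_scaled_int R L.
pose z v w := Num.floor (n%:R * ratr (dot v w) : R).
have zE v w : n%:R * ratr (dot v w) = (z v w)%:~R :> R.
  by have [u uE] := nint v w; rewrite /z uE intrKfloor.
pose Delta : R := n%:R ^+ 2 * area p m ab0.1 ab0.2 ^+ 2 / 4.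
pose B := Num.bound Delta.
have DB : Delta < B%:R by apply: archi_boundP; apply: divr_ge0 => //; apply: mulr_ge0; exact: sqr_ge0.
have bnd i : [/\ `|z (a i) (a i)| < B%:Z, `|z (a i) (b i)| < B%:Z & `|z (b i) (b i)| < B%:Z].
  have [_ /= pa ma pb mb] := sr i; rewrite -/(a i) -/(b i) in pa ma pb mb.
  have : (z (a i) (b i) ^+ 2 - z (a i) (a i) * z (b i) (b i))%:~R < B%:Z%:~R :> R.
    apply: le_lt_trans DB; rewrite /Delta -(sA i) intrB expr2 !intrM -!zE !(nc_dot nc) /area.
    by rewrite le_eqVlt; apply/orP; left; apply/eqP; field.
  have : 0 < (z (a i) (a i))%:~R :> R.
    by rewrite -zE -/(norm2 _) (nc_norm nc) !mulr_gt0 ?ltr0n.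
  have : (z (b i) (b i))%:~R < 0 :> R.
    by rewrite -zE -/(norm2 _) (nc_norm nc) pmulr_rlt0 ?ltr0n// nmulr_rlt0.
  rewrite ltr_int ltrz0 ltr0z; move: (z _ _) (z _ _) (z _ _) => zbb zaa zab bb aa h.
  split; [nia | nia | nia].
pose enc (k : int) : 'I_(2 * B).+1 := inord (absz (k + B%:Z)).
have enc_inj k k' : `|k| < B%:Z -> `|k'| < B%:Z -> enc k = enc k' -> k = k'.
  move=> kB lB /(congr1 val); rewrite /= !inordK; lia.
have [i [j [ij]]] := pigeonhole
  (fun i => (enc (z (a i) (a i)), enc (z (a i) (b i)), enc (z (b i) (b i)))).
have [i1 i2 i3] := bnd i; have [j1 j2 j3] := bnd j.
case=> /(enc_inj _ _ i1 j1) e1 /(enc_inj _ _ i2 j2) e2 /(enc_inj _ _ i3 j3) e3.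
have zinj v w v' w' : z v w = z v' w' -> dot v w = dot v' w'.
  move=> e; apply: (fmorph_inj (ratr : {rmorphism rat -> R})); rewrite /=.
  by apply: (@mulfI _ n%:R); rewrite ?pnatr_eq0 ?gtn_eqF// !zE e.
have gram_eq : innermx (a i) (b i) = innermx (a j) (b j).
  apply/matrixP => k k'; elim/ord2P: k; elim/ord2P: k'; rewrite !mxE /=; try exact: zinj.
  by rewrite dot_sym [RHS]dot_sym; exact: zinj.
have [iZ /= ipa ima ipb imb] := sr i; have [jZ /= jpa jma jpb jmb] := sr j.
have A0 : 0 < area p m ab0.1 ab0.2.
  by rewrite -(sA i) /area subr_gt0 (@lt_trans _ _ 0)// ?pmulr_rlt0// mulr_gt0.
have bg : boost p m (p (a j) / p (a i)) (linmap [tuple a i; b i] [tuple a j; b j]).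
  by apply: (gram_boost aniso nc) => //; rewrite sA.
exists (p (a j) / p (a i)), (linmap [tuple a i; b i] [tuple a j; b j]); split=> //.
set t := _ / _ in bg *; have [_ _ t0 gp _] := bg.
have pa : p (a j) = t * p (a i).
  by rewrite -gp; congr (p _); rewrite (linmap_tnth [tuple a j; b j] 0 iZ).
have pb : p (b j) = t * p (b i).
  by rewrite -gp; congr (p _); rewrite (linmap_tnth [tuple a j; b j] 1 iZ).
have := sdec i j ij; rewrite pa pb -mulrBr => h.
have pp : 0 < p (a i) - p (b i) by rewrite subr_gt0 (lt_trans ipb).
by rewrite -(ltr_pM2r pp) mul1r.
Qed.

End RiverWalk.

(** * Canonical supplements and short vectors *)

Section ShortVectors.
Context (R : realType) (L : lorentzian2) (S : set 'rV[R]_2) (o : 'M[R]_2).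
Context (p m : {additive L -> R}).
Context (aniso : anisotropic L) (nc : null_coordinates S o p m).
Implicit Types (r l v w x y : L) (g h : L -> L) (M t : R).

Lemma precedesP v w : precedes S o v w <->
  [/\ 0 < p v, 0 < m v, 0 < p w, 0 < m w & 0 < area p m v w].
Proof.
split=> [[/(nc_S nc)[? ?] /(nc_S nc)[? ?] /(nc_oriented nc)] //|[? ? ? ? ?]].
by split; [apply/(nc_S nc) | apply/(nc_S nc) | apply/(nc_oriented nc)].
Qed.

Lemma precedes_trans v w x : precedes S o v w -> precedes S o w x -> precedes S o v x.
Proof.
move=> /precedesP[pv mv pw mw D1] /precedesP[_ _ px mx D2]; apply/precedesP; split=> //.
have -> : area p m v x = (p v * area p m w x + p x * area p m v w) / p w.
  by rewrite /area; field; rewrite gt_eqF.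
by rewrite divr_gt0// addr_gt0// mulr_gt0.
Qed.

Lemma precedes_asym v w : precedes S o v w -> ~ precedes S o w v.
Proof. by move=> /precedesP[_ _ _ _ D1] /precedesP[_ _ _ _]; move: D1; rewrite /area; lra. Qed.

Lemma oriented_basisP r l : oriented_basis o r l <->
  Zbasis [tuple r; l] /\ 0 < area p m r l.
Proof. by split=> -[rl D]; split=> //; apply/(nc_oriented nc). Qed.

Lemma first_short_after_uniq M r x y :
  first_short_after S o M r x -> first_short_after S o M r y -> x = y.
Proof.
move=> [sx fx] [sy fy]; have [//|xy] := fx _ sy; have [//|/precedes_asym] := fy _ sx.
by [].
Qed.

(** The areas of the two bases are positive integer multiples of each other, hence equal. *)
Lemma oriented_basis_shear r l l' : oriented_basis o r l -> oriented_basis o r l' ->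
  exists n : int, l' = l + r *~ n.
Proof.
move=> /oriented_basisP[rl D] /oriented_basisP[rl' D'].
have [/(_ l')[i [j l'E]] _] := (ZbasisP _ _).1 rl.
have [/(_ l)[i' [j' lE]] _] := (ZbasisP _ _).1 rl'.
have rE : r = r *~ 1 + l *~ 0 by rewrite mulr1z mulr0z addr0.
have rE' : r = r *~ 1 + l' *~ 0 by rewrite mulr1z mulr0z addr0.
have e1 : area p m r l' = j%:~R * area p m r l.
  by rewrite l'E {1}rE area_lincomb mul1r mul0r subr0.
have e2 : area p m r l = j'%:~R * area p m r l'.
  by rewrite {1}lE {1}rE' area_lincomb mul1r mul0r subr0.
have j0 : 0 < j by move: D'; rewrite e1 pmulr_lgt0// ltr0z.
have j0' : 0 < j' by move: D; rewrite e2 pmulr_lgt0// ltr0z.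
have : (j' * j)%:~R = 1 :> R.
  by apply: (mulIf (lt0r_neq0 D)); rewrite intrM -mulrA -e1 -e2 mul1r.
move=> /eqP; rewrite (eqr_int R _ 1) => /eqP jj.
exists i; rewrite l'E addrC; have -> : j = 1 by nia.
by rewrite mulr1z.
Qed.

(** Adding vectors of [S] to a vector beyond the norm [M] hyperbola leads further beyond it; so the
supplements of [r] among the [l + r *~ n] form an initial segment, and only one of them can be
the last. *)
Lemma beyond_shear M r l (n : nat) : S (toP R r) ->
  S (toP R l) /\ M < ratr (norm2 l) ->
  S (toP R (l + r *+ n)) /\ M < ratr (norm2 (l + r *+ n)).
Proof.
move=> /(nc_S nc)[pr mr]; rewrite !(nc_norm nc) => -[/(nc_S nc)[pl ml] Ml].
rewrite (nc_S nc) !(raddfD p) !(raddfD m) pmulrn pMz mMz -pmulrn.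
have n0 := ler0n R n; have pn := mulr_ge0 (ltW pr) n0; have mn := mulr_ge0 (ltW mr) n0.
split; first by rewrite !ltr_wpDr.
apply: (lt_le_trans Ml); rewrite ler_pM ?lerDl// ltW//.
Qed.

Lemma canonical_supplement_uniq M r l l' : S (toP R r) ->
  canonical_supplement S o M r l -> canonical_supplement S o M r l' -> l = l'.
Proof.
move=> rS; wlog : l l' / exists n : nat, l' = l + r *+ n.
  move=> W cl cl'; have [n nE] := oriented_basis_shear cl.1.1 cl'.1.1.
  case: n nE => n; first by move=> nE; apply: W => //; exists n; rewrite nE -pmulrn.
  move=> nE; apply/esym; apply: W => //; exists n.+1.
  by rewrite nE NegzE mulrNz -pmulrn addrNK.
move=> [[|n] ->]; first by rewrite mulr0n addr0.
move=> [[rl _] nl] [[rl' nl'] _]; exfalso; apply: nl.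
have rlr : oriented_basis o r (l + r).
  move: rl => /oriented_basisP[rl D]; apply/oriented_basisP; split.
    by have := Zbasis_shear 1 rl; rewrite mulr1z.
  by move: D; rewrite /area !raddfD; lra.
split=> // bey; apply: nl'; rewrite mulrS addrA; exact: beyond_shear.
Qed.

Section BoostTransport.
Context (t : R) (g : L -> L) (bg : boost p m t g).

Lemma boost_inv h : cancel g h -> cancel h g -> boost p m t^-1 h.
Proof.
have [gD gbij t0 gp gm] := bg => gK hK; split.
- exact: (morphD_inv gD gbij hK).
- by exists g.
- by rewrite invr_gt0.
- by move=> v; rewrite -{2}(hK v) gp mulKf// gt_eqF.
- by move=> v; rewrite -{2}(hK v) gm invrK mulVKf// gt_eqF.
Qed.

Lemma boost_S v : S (toP R (g v)) <-> S (toP R v).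
Proof.
by have [_ _ t0 gp gm] := bg; rewrite !(nc_S nc) gp gm !pmulr_rgt0 ?invr_gt0.
Qed.

Lemma boost_norm v : norm2 (g v) = norm2 v.
Proof. exact: (boost_dot (nc_norm nc) bg). Qed.

Lemma boost_area v w : area p m (g v) (g w) = area p m v w.
Proof. by have [_ _ t0 gp gm] := bg; rewrite /area !gp !gm; field; rewrite gt_eqF. Qed.

Lemma boost_innermx v w : innermx (g v) (g w) = innermx v w.
Proof.
apply/matrixP => i j; elim/ord2P: i; elim/ord2P: j;
  rewrite !mxE; exact: (boost_dot (nc_norm nc) bg).
Qed.

Lemma boost_oriented_basis r l : oriented_basis o r l -> oriented_basis o (g r) (g l).
Proof.
have [gD gbij _ _ _] := bg => /oriented_basisP[rl D]; apply/oriented_basisP.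
rewrite boost_area; split=> //; have := Zbasis_morph gD gbij rl.
by congr Zbasis; apply: eq_from_tnth; elim/ord2P; rewrite tnth_map.
Qed.

Lemma boost_supplement M r l : supplement S o M r l -> supplement S o M (g r) (g l).
Proof.
move=> [rl nl]; split; first exact: boost_oriented_basis.
by rewrite boost_S boost_norm.
Qed.

Lemma boost_short_after M r x : short_after S o M r x -> short_after S o M (g r) (g x).
Proof.
have [gD gbij _ _ _] := bg => -[px Sx nx [Sr _ rx]].
split; rewrite ?boost_norm//; [exact: (primitive_morph gD gbij) | exact/boost_S |].
split; [exact/boost_S | exact/boost_S |].
by apply/(nc_oriented nc); rewrite boost_area; apply/(nc_oriented nc).
Qed.

End BoostTransport.

Lemma boost_canonical t g M r l : boost p m t g ->
  canonical_supplement S o M r l -> canonical_supplement S o M (g r) (g l).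
Proof.
move=> bg [rl nl]; split; first exact: boost_supplement bg _ _ _ rl.
have [gD [h gK hK] _ _ _] := bg; rewrite -gD => sg; apply: nl.
by have := boost_supplement (boost_inv bg gK hK) sg; rewrite !gK.
Qed.

Lemma boost_first_short_after t g M r x : boost p m t g ->
  first_short_after S o M r x -> first_short_after S o M (g r) (g x).
Proof.
move=> bg [sx fx]; split; first exact: (boost_short_after bg).
have [gD [h gK hK] _ _ _] := bg; have bh := boost_inv bg gK hK.
move=> y /(boost_short_after bh); rewrite gK => /fx[<-|hxy]; [left | right]; rewrite ?hK//.
move: hxy => [? ? xy]; rewrite -(hK y); split; [exact/(boost_S bg) | exact/(boost_S bg) |].
by apply/(nc_oriented nc); rewrite (boost_area bg); apply/(nc_oriented nc).
Qed.

(** A boost with factor [t] multiplies the slope [m / p] by [t ^- 2]. *)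
Lemma boost_precedes t g r : boost p m t g -> t < 1 -> S (toP R r) -> precedes S o r (g r).
Proof.
move=> bg t1 Sr; have /(boost_S bg)/(nc_S nc)[pg mg] := Sr; have /(nc_S nc)[pr mr] := Sr.
have [_ _ t0 gp gm] := bg; apply/precedesP; split=> //.
have -> : area p m r (g r) = p r * m r * (t^-1 - t) by rewrite /area gp gm; ring.
by rewrite mulr_gt0 ?mulr_gt0// subr_gt0 (lt_trans t1)// invf_gt1.
Qed.

(** The quotient of the two areas is an integer, the determinant of a change of basis. *)
Lemma area_ge_basis a b v w : oriented_basis o a b -> 0 < area p m v w ->
  area p m a b <= area p m v w.
Proof.
move=> /oriented_basisP[/ZbasisP[gen _] D].
have [i [j ->]] := gen v; have [k [l ->]] := gen w.
rewrite area_lincomb pmulr_lgt0// ltr0z gtz0_ge1 => h.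
by rewrite -[X in X <= _]mul1r ler_pM2r// ler1z.
Qed.

(** The slope [s = m / p] grows at each step by the area of two consecutive terms divided by
[p (u i) * p (u i.+1)].  The area is at least the covolume, and [p ^+ 2 = p * m / s] is at most
[M] divided by the first slope; so the slopes exceed that of [x] eventually. *)
Lemma short_sequence_reaches M (u : nat -> L) x :
  (forall i, short_after S o M (u i) (u i.+1)) -> ratr (norm2 (u 0%N)) <= M ->
  (exists a b : L, oriented_basis o a b) ->
  exists i, ~ precedes S o (u i) x.
Proof.
move=> us u0 [a [b ab]]; apply: contrapT => /forallNP nx.
have {}nx i : precedes S o (u i) x by apply: contrapT; exact: nx.
have uM i : p (u i) * m (u i) <= M.
  by case: i => [|i]; rewrite -(nc_norm nc)//; have [] := us i.
have ux i := (precedesP _ _).1 (nx i).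
have [pu mu px mx _] := ux 0%N.
pose s i := m (u i) / p (u i).
have s0 : 0 < s 0%N by rewrite divr_gt0.
pose c := M / s 0%N.
have M0 : 0 < M by apply: lt_le_trans (uM 0%N); rewrite mulr_gt0.
have c0 : 0 < c by rewrite divr_gt0.
have [_ D] := (oriented_basisP _ _).1 ab.
pose eps := area p m a b / c.
have eps0 : 0 < eps by rewrite divr_gt0.
have growth i : s 0%N <= s i -> s i + eps <= s i.+1.
  move=> si; have [pi mi _ _ _] := ux i; have [pi' mi' _ _ _] := ux i.+1.
  have psq j : p (u j) ^+ 2 <= c \/ s j < s 0%N.
    have [sj|] := leP (s 0%N) (s j); [left | by right].
    have [pj mj _ _ _] := ux j.
    rewrite ler_pdivlMr// (le_trans _ (uM j))// (le_trans (ler_wpM2l _ sj)) ?sqr_ge0//.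
    by rewrite /s expr2 -mulrA [_ * (_ / _)]mulrCA mulfV ?mulr1 ?gt_eqF.
  have := us i; rewrite /short_after => -[_ _ _ /precedesP[_ _ _ _ A]].
  have Dle := area_ge_basis ab A.
  have sE : s i.+1 - s i = area p m (u i) (u i.+1) / (p (u i) * p (u i.+1)).
    by rewrite /s /area; field; rewrite !gt_eqF.
  have [ps|] := psq i; last by rewrite ltNge si.
  have si' : s i < s i.+1 by rewrite -subr_gt0 sE divr_gt0 ?mulr_gt0.
  have [ps'|] := psq i.+1; last by rewrite ltNge (le_trans si (ltW si')).
  have pp : p (u i) * p (u i.+1) <= c by have := sqr_ge0 (p (u i) - p (u i.+1)); nra.
  rewrite addrC -lerBrDr sE /eps ler_pM ?invr_ge0 ?(ltW c0) ?(ltW D)//.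
  by rewrite lef_pV2 ?posrE// mulr_gt0.
have sge i : s 0%N + i%:R * eps <= s i.
  elim: i => [|i IH]; first by rewrite mul0r addr0.
  rewrite -natr1 mulrDl mul1r addrA (le_trans _ (growth i _))// ?lerD2r//.
  by apply: le_trans IH; rewrite lerDl mulr_ge0 ?ler0n// ltW.
have sx i : s i < m x / p x.
  have [pi mi _ _] := ux i; rewrite /area subr_gt0 => h.
  by rewrite ltr_pdivrMr// mulrAC ltr_pdivlMr// [X in _ < X]mulrC.
pose k := Num.bound (m x / p x / eps).
have : m x / p x / eps < k%:R by apply: archi_boundP; rewrite !divr_ge0 ?ltW.
rewrite ltr_pdivrMr// => h.
have := sx k; have := sge k; lra.
Qed.

End ShortVectors.

(** * The run of the algorithm *)

Section Trajectory.
Context (R : realType) (L : lorentzian2) (S : set 'rV[R]_2) (o : 'M[R]_2).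
Context (p m : {additive L -> R}).
Context (aniso : anisotropic L) (nc : null_coordinates S o p m).
Context (canonical : R -> L -> L -> L) (promised : R -> L -> L -> L * L).
Context (hcan : Canonical_spec S o canonical) (hprom : Promised_spec S o promised).
Context (M : R) (r1 l1 : L).
Context (M0 : 0 < M) (r1S : S (toP R r1)) (r1prim : primitive r1).
Context (r1M : ratr (norm2 r1) <= M) (cl1 : canonical_supplement S o M r1 l1).

Definition loop_step (s : L * L) : L * L :=
  let s' := promised M s.1 s.2 in (s'.1, canonical M s'.1 s'.2).

(** The values of [(r, l)] that the loop would go through if it never stopped. *)
Definition traj (i : nat) : L * L := iter i loop_step (r1, l1).

Let bas : Zbasis [tuple r1; l1] := cl1.1.1.1.
Let D1 : 0 < area p m r1 l1. Proof. by have [_ /(nc_oriented nc)] := cl1.1.1. Qed.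

Lemma contraction : exists (t : R) (g : L -> L), boost p m t g /\ t < 1.
Proof.
have [pr mr] := (nc_S nc _).1 r1S.
exact: (contracting_boost_exists aniso nc bas D1 pr mr).
Qed.

(** The subroutine Promised may be called at each step because a contracting boost takes the
current vector to a later short one. *)
Lemma traj_spec i :
  [/\ primitive (traj i).1, S (toP R (traj i).1), ratr (norm2 (traj i).1) <= M &
      canonical_supplement S o M (traj i).1 (traj i).2] /\
  first_short_after S o M (traj i).1 (traj i.+1).1.
Proof.
have [t [g [bg t1]]] := contraction.
have stp s : primitive s.1 -> S (toP R s.1) -> ratr (norm2 s.1) <= M ->
    canonical_supplement S o M s.1 s.2 ->
    first_short_after S o M s.1 (loop_step s).1 /\
    canonical_supplement S o M (loop_step s).1 (loop_step s).2.
  move=> sp sS sM sc; have [|fs ss] := hprom M0 sp sS sc.1.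
    exists (g s.1); split; rewrite ?(boost_norm nc bg)//.
    - by have [gD gbij _ _ _] := bg; exact: primitive_morph.
    - exact/(boost_S nc bg).
    - exact: (boost_precedes nc bg).
  split=> //; apply: hcan => //; last exact: ss.1.
  by have [[]] := fs.
elim: i => [|i [[ip iS iM ic] fi]].
  by split; [split | have [] := stp (r1, l1)].
have [_ ic'] := stp _ ip iS iM ic; have [[ip' iS' iM' _] _] := fi.
by split; [split | have [] := stp (traj i.+1)].
Qed.

Lemma traj_prec i j : (i < j)%N -> precedes S o (traj i).1 (traj j).1.
Proof.
apply: (@homo_ltn _ (fun i => (traj i).1) (fun v w => precedes S o v w)).
  by move=> y x z; exact: (precedes_trans nc).
by move=> k; have [_ [[]]] := traj_spec k.
Qed.

Lemma traj_reaches x : short_after S o M r1 x -> exists2 i, (0 < i)%N & x = (traj i).1.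
Proof.
move=> sx; have [px Sx xM r1x] := sx.
have [|||i nix] := @short_sequence_reaches _ _ _ _ _ _ nc M (fun i => (traj i).1) x.
- by move=> i; have [_ []] := traj_spec i.
- exact: r1M.
- by exists r1, l1; exact: cl1.1.1.
have : (exists2 j, (0 < j <= i)%N & x = (traj j).1) \/ precedes S o (traj i).1 x.
  elim: {nix} i => [|i [[j /andP[j0 ji] xj]|ix]]; first by right.
    by left; exists j; rewrite // j0 (leq_trans ji).
  have [_ [_ fi]] := traj_spec i; have [//|xi|] := fi x; last by right.
  by left; exists i.+1; rewrite ?leqnn.
by case=> [[j /andP[j0 _] xj]|//]; exists j.
Qed.

Lemma traj_canonical i l : canonical_supplement S o M (traj i).1 l -> l = (traj i).2.
Proof.
by have [[_ iS _ ic] _] := traj_spec i; move=> cl; apply: (canonical_supplement_uniq nc iS cl ic).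
Qed.

Lemma boost_reaches t g : boost p m t g -> t < 1 ->
  exists2 i, (0 < i)%N & (g r1, g l1) = traj i.
Proof.
move=> bg t1; have [|i i0 gi] := @traj_reaches (g r1).
  split; rewrite ?(boost_norm nc bg)//.
  - by have [gD gbij _ _ _] := bg; exact: primitive_morph.
  - exact/(boost_S nc bg).
  - exact: (boost_precedes nc bg).
exists i => //; have := boost_canonical nc bg cl1; rewrite gi => /traj_canonical ->.
by case: (traj i).
Qed.

Definition returns (i : nat) : bool := innermx (traj i).1 (traj i).2 == innermx r1 l1.

(** The image of [(r1, l1)] under a contracting boost is in the sequence and has the same Gram
matrix. *)
Lemma returns_exists : exists i, (0 < i)%N && returns i.
Proof.
have [t [g [bg t1]]] := contraction; have [i i0 gi] := boost_reaches bg t1.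
by exists i; rewrite i0 /returns -gi /= (boost_innermx nc bg).
Qed.

Lemma body_run i : (forall j, (0 < j <= i)%N -> ~~ returns j) ->
  iter i (Anisotropic_body canonical promised M r1 l1) (Running [:: r1] r1 l1) =
  Running (mkseq (fun j => (traj j).1) i.+1) (traj i).1 (traj i).2.
Proof.
elim: i => // i IH nret; rewrite iterS IH /=; last first.
  by move=> j /andP[j0 ji]; apply: nret; rewrite j0 leqW.
have := nret i.+1 (leqnn _); rewrite /returns /= => /negbTE ->.
by rewrite [in RHS]mkseqS.
Qed.

Lemma body_halt i : (forall j, (0 < j <= i)%N -> ~~ returns j) -> returns i.+1 ->
  iter i.+1 (Anisotropic_body canonical promised M r1 l1) (Running [:: r1] r1 l1) =
  Halted (Generator (linmap [tuple r1; l1] [tuple (traj i.+1).1; (traj i.+1).2])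
    (mkseq (fun j => (traj j).1) i.+1)).
Proof. by move=> /body_run run; rewrite iterS run /= /returns /= => ->. Qed.

Section Period.
Context (k : nat).
Context (k0 : (0 < k)%N) (kret : returns k)
  (kmin : forall j, (0 < j < k)%N -> ~~ returns j).

Let g := linmap [tuple r1; l1] [tuple (traj k).1; (traj k).2].

Lemma period_boost : exists t, boost p m t g.
Proof.
have [[_ kS _ [[[kb kD] _] _]] _] := traj_spec k.
have [pk mk] := (nc_S nc _).1 kS; have [pr mr] := (nc_S nc _).1 r1S.
exists (p (traj k).1 / p r1); apply: (gram_boost aniso nc) => //.
- exact/(nc_oriented nc).
- exact/esym/eqP.
Qed.

(** First short vectors and canonical supplements are unique and respected by the boost [g], so
[g] commutes with the steps of the loop. *)
Lemma period_shift i : (g (traj i).1, g (traj i).2) = traj (i + k).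
Proof.
have [t bg] := period_boost.
elim: i => [|i IH].
  rewrite add0n [RHS]surjective_pairing /=; congr pair.
    exact: (linmap_tnth [tuple (traj k).1; (traj k).2] 0 bas).
  exact: (linmap_tnth [tuple (traj k).1; (traj k).2] 1 bas).
have [[_ _ _ ic'] _] := traj_spec i.+1; have [_ fi] := traj_spec i.
have := boost_first_short_after nc bg fi; rewrite [g _](congr1 fst IH) => f1.
have [_ f2] := traj_spec (i + k)%N.
have e1 : g (traj i.+1).1 = (traj (i.+1 + k)).1 := first_short_after_uniq nc f1 f2.
have := boost_canonical nc bg ic'; rewrite e1 => /traj_canonical ->.
by case: (traj _).
Qed.

Lemma period_iter q i : (iter q g (traj i).1, iter q g (traj i).2) = traj (i + q * k).
Proof.
elim: q => [|q IH]; first by rewrite mul0n addn0 -surjective_pairing.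
by rewrite /= mulSn [(k + _)%N]addnC addnA -period_shift -IH.
Qed.

Lemma unrolledE j : unrolled g (mkseq (fun j => (traj j).1) k) j = (traj j).1.
Proof.
rewrite /unrolled size_mkseq nth_mkseq ?ltn_mod//.
by have /(congr1 fst) /= -> := period_iter (j %/ k) (j %% k); rewrite addnC -divn_eq.
Qed.

(** If [t = 1] then [h] fixes the coordinate [p], which is injective on the lattice.  If
[t < 1], some power of [g] takes a pair with index less than [k] to the image of [(r1, l1)] under
[h].  This pair has the initial Gram matrix, so its index is 0 by the minimality of [k], and [h]
agrees with that power of [g] on a basis. *)
Lemma boost_le1_power t h : boost p m t h -> t <= 1 ->
  exists q, forall v, h v = iter q g v.
Proof.
move=> bh; have [hD hbij _ hp _] := bh; rewrite le_eqVlt => /orP[/eqP t1|t1].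
  exists 0%N => v /=; apply/eqP; rewrite -subr_eq0; apply/eqP.
  apply: contrapT => /(nc_neq0 aniso nc).
  by rewrite raddfB /= hp t1 mul1r subrr mul0r eqxx.
have [j j0 hj] := boost_reaches bh t1; have [t' bg] := period_boost.
have : returns j by rewrite /returns -hj /= (boost_innermx nc bh).
have giD q : {morph iter q g : x y / x + y}.
  by have [gD _ _ _ _] := bg; elim: q => // q IH x y /=; rewrite IH gD.
have inn q v w : innermx (iter q g v) (iter q g w) = innermx v w.
  by elim: q => //= q <-; rewrite (boost_innermx nc bg).
have e := period_iter (j %/ k) (j %% k); rewrite addnC -divn_eq in e.
rewrite /returns -e /= inn => jret.
have /eqP jk : (j %% k == 0)%N.
  apply/negPn/negP => jk; have jlt : (0 < j %% k < k)%N by rewrite lt0n jk ltn_mod.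
  exact: (negP (kmin jlt) jret).
exists (j %/ k)%N; apply: (morphD_eq bas) => //.
by move: hj; rewrite -e jk => -[e1 e2]; elim/ord2P.
Qed.

(** A boost or its inverse has factor at most 1. *)
Lemma period_generates : generates_SOup R g.
Proof.
have [t bg] := period_boost; split; first by apply/(nc_SOup nc); exists t.
move=> h /(nc_SOup nc)[u bh]; have [u1|u1] := leP u 1.
  by have [q hq] := boost_le1_power bh u1; exists q; left.
have [_ [h' hK h'K] u0 _ _] := bh; have bh' := boost_inv bh hK h'K.
have [|q hq] := boost_le1_power bh'; first by rewrite invf_le1// ltW.
by exists q; right=> v; rewrite -hq hK.
Qed.

End Period.
End Trajectory.

Theorem mainTheorem5 (R : realType) (L : lorentzian2) (hL : anisotropic L)
  (S : set 'rV[R]_2) (hS : component (nonneg_vectors R L) S)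
  (o : 'M[R]_2) (ho : o \in unitmx)
  (canonical : R -> L -> L -> L) (hcan : Canonical_spec S o canonical)
  (promised : R -> L -> L -> L * L) (hprom : Promised_spec S o promised)
  (notPromised : R -> L -> L -> option (L * L))
  (hnot : NotPromised_spec S o notPromised)
  (r0 : L) (hr0S : S (toP R r0)) (hr0 : primitive r0)
  (M : R) (hM : 0 < M)
  (l0 : L) (hl0 : canonical_supplement S o (ratr (norm2 r0)) r0 l0) :
  exists out : output L,
    [/\ Anisotropic_returns canonical promised notPromised M r0 l0 out,
        no_short_spacelike L M -> out = NoShortSpacelike L
      & ~ no_short_spacelike L M ->
        exists (g : L -> L) (rs : seq L),
          [/\ out = Generator g rs,
              generates_SOup R g,
              rs <> [::]
            & ascending_enumeration S o [set x | short_after S o M r0 x]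
                (unrolled g rs)]].
Proof.
have [p [m nc]] := null_coordinates_exist hL hS ho.
have [none some] := hnot _ _ _ hM hr0 hr0S hl0.
have [short|short] := EM (no_short_spacelike L M).
  exists (NoShortSpacelike L); split=> //.
  by exists 0%N; rewrite /Anisotropic_state none.
have [r1 [l1 [run0 f1 cl1]]] := some short; have [[r1p r1S r1M r01] f1'] := f1.
have ex := returns_exists hL nc hcan hprom hM r1S r1p r1M cl1.
pose k := ex_minn ex; have : (0 < k)%N && returns canonical promised M r1 l1 k.
  by rewrite /k; case: ex_minnP.
move=> /andP[k0 kret].
have kmin j : (0 < j < k)%N -> ~~ returns canonical promised M r1 l1 j.
  move=> /andP[j0]; rewrite /k; case: ex_minnP => n _ nmin; apply: contraTN => jr.
  by rewrite -leqNgt nmin// j0.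
pose tr := traj canonical promised M r1 l1.
pose g := linmap [tuple r1; l1] [tuple (tr k).1; (tr k).2].
pose rs := mkseq (fun j => (tr j).1) k.
have uE := unrolledE hL nc hcan hprom hM r1S r1p r1M cl1 k0 kret.
exists (Generator g rs); split=> //.
- exists k; rewrite /Anisotropic_state run0 /g /rs.
  move: k0 kret kmin => {uE g rs}; case: k => // k _ kret kmin.
  by rewrite body_halt// => j /andP[j0 jk]; apply: kmin; rewrite j0.
- move=> _; exists g, rs; split=> //.
  + exact: (period_generates hL nc hcan hprom hM r1S r1p r1M cl1 k0 kret kmin).
  + by rewrite /rs => /(congr1 size); rewrite size_mkseq => k00; rewrite k00 in k0.
  split=> [|i j ij]; last first.
    by rewrite !uE; exact: (traj_prec hL nc hcan hprom hM r1S r1p r1M cl1).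
  have tspec := traj_spec hL nc hcan hprom hM r1S r1p r1M cl1.
  apply/seteqP; split=> [_ [j _ <-]|x sx].
    rewrite /= uE; have [[jp jS jM _] _] := tspec j; split=> //.
    case: j {jp jS jM} => [//|j]; apply: (precedes_trans nc r01).
    exact: (traj_prec hL nc hcan hprom hM r1S r1p r1M cl1 (ltn0Sn j)).
  have [j xj] : exists j, x = (tr j).1.
    have [->|r1x] := f1' _ sx; first by exists 0%N.
    have [px Sx xM _] := sx.
    have [|j _ xj] := traj_reaches hL nc hcan hprom hM r1S r1p r1M cl1 (x := x); first by split.
    by exists j.
  by exists j; rewrite // uE -xj.
Qed.
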